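(* Assume the setting in the context, including $\int_\Omega|\log p(\omega,e)|^{d+\alpha}\,d\mathbb{P}<\infty$ for some $\alpha>0$ and all $e\in U$. Let $\lambda\in\mathbb{R}^d$. Then for each $\varepsilon>0$ there exists a function $F_\varepsilon\in\mathcal{K}$ such that $$\operatorname*{ess\,sup}_{\omega}\log\sum_{e\in U}p(\omega,e)\,\mathrm{e}^{\langle\lambda,e\rangle+F_\varepsilon(\omega,e)}\le\Gamma(\lambda)+\varepsilon.$$
   Context: Let $d\ge 1$ and $U=\{e\in\mathbb{Z}^d: |e|=1\}$. Let $(\Omega,\mathcal{F},\mathbb{P})$ be a probability space with $\mathcal{F}$ countably generated, and let $\{T_e\}_{e\in U}$ be commuting $\mathbb{P}$-measure-preserving transformations with $T_{-e}=T_e^{-1}$, forming an ergodic family (every event invariant under all $T_e$ has probability $0$ or $1$); $T_x=T_{e_1}^{x_1}\cdots T_{e_d}^{x_d}$. Let $p:\Omega\times U\to[0,1]$ be measurable with $\sum_{e}p(\omega,e)=1$. A function $F:\Omega\times U\to\mathbb{R}$ is in class $\mathcal{K}$ if: (i) there is $\alpha>0$ with $\mathbb{E}[|F(\cdot,e)|^{d+\alpha}]<\infty$ for every $e$; (ii) $\mathbb{E}[F(\cdot,e)]=0$ for every $e$; (iii) ($\mathbb{P}$-a.s.) for every finite sequence $x_0,\dots,x_n\in\mathbb{Z}^d$ with $x_{i+1}-x_i\in U$ and $x_0=x_n$, $\sum_{i=0}^{n-1}F(T_{x_i}\omega,x_{i+1}-x_i)=0$. $$\Gamma(\lambda)=\sup_{(q,\phi)}\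 \inf_h\ \int_\Omega\sum_{e\in U}\left(\langle\lambda,e\rangle-\log\frac{q(\omega,e)}{p(\omega,e)}+h(\omega)-h(T_e\omega)\right)q(\omega,e)\,\phi(\omega)\,d\mathbb{P},$$ the supremum over measurable transition functions $q:\Omega\times U\to[0,1]$ with $\sum_e q(\omega,e)=1$ and probability densities $\phi$ with respect to $\mathbb{P}$, the infimum over bounded measurable $h$. Essential suprema are with respect to $\mathbb{P}$. *)

(* Defs.v *)
From HB Require Import structures.
From mathcomp Require Import all_boot all_order all_algebra.
From mathcomp Require Import all_classical all_reals all_analysis ess_sup_inf.
Set Implicit Arguments. Unset Strict Implicit. Unset Printing Implicit Defensive.
Import Order.TTheory GRing.Theory Num.Theory.
Import numFieldNormedType.Exports.
Local Open Scope classical_set_scope.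
Local Open Scope ring_scope.

(* The set U = {e in Z^d : |e| = 1} = {+-e_i}, encoded by the finite type
   'I_n * bool : (i, true) is e_i and (i, false) is -e_i. *)
Definition dir (n : nat) := ('I_n * bool)%type.

Definition unitvec (n : nat) (e : dir n) : 'I_n -> int :=
  fun j => if j == e.1 then (if e.2 then 1 else -1) else 0.

Definition ip (R : realType) (n : nat) (lam : 'I_n -> R) (e : dir n) : R :=
  \sum_(j < n) lam j * (unitvec e j)%:~R.

Definition Tpow (Om : Type) (n : nat) (T : dir n -> Om -> Om) (i : 'I_n)
  (k : int) : Om -> Om :=
  match k with
  | Posz m => iter m (T (i, true))
  | Negz m => iter m.+1 (T (i, false))
  end.

Definition Tx (Om : Type) (n : nat) (T : dir n -> Om -> Om) (x : 'I_n -> int)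
  : Om -> Om :=
  foldr (fun i f => Tpow T i (x i) \o f) id (enum 'I_n).

Definition ergodic_family (R : realType) (dd : measure_display)
  (Om : measurableType dd) (P : probability Om R) (n : nat)
  (T : dir n -> Om -> Om) : Prop :=
  (forall e e', T e \o T e' = T e' \o T e) /\
  (forall i : 'I_n, T (i, true) \o T (i, false) = id /\
                    T (i, false) \o T (i, true) = id) /\
  (forall e, measurable_fun setT (T e)) /\
  (forall e (A : set Om), measurable A -> P (T e @^-1` A) = P A) /\
  (forall A : set Om, measurable A -> (forall e, T e @^-1` A = A) ->
     P A = 0%E \/ P A = 1%E).

Definition countably_generated (dd : measure_display) (Om : measurableType dd)
  : Prop :=
  exists G : nat -> set Om, (@measurable dd Om) = <<s range G>>.

Definition endpt (n : nat) (x0 : 'I_n -> int) (s : seq (dir n)) : 'I_n -> int :=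
  fun j => x0 j + \sum_(e <- s) unitvec e j.

(* sum_{i=0}^{m-1} F(T_{x_i} w, x_{i+1} - x_i) along the path
   x_0 = x0, x_{i+1} = x_i + s_i *)
Fixpoint path_sum (R : realType) (Om : Type) (n : nat)
  (T : dir n -> Om -> Om) (F : Om -> dir n -> R) (w : Om)
  (x : 'I_n -> int) (s : seq (dir n)) : R :=
  match s with
  | [::] => 0
  | e :: s' => F (Tx T x w) e + path_sum T F w (fun j => x j + unitvec e j) s'
  end.

Definition classK (R : realType) (dd : measure_display)
  (Om : measurableType dd) (P : probability Om R) (n : nat)
  (T : dir n -> Om -> Om) (F : Om -> dir n -> R) : Prop :=
  (exists2 alpha : R, 0 < alpha &
     forall e, measurable_fun setT (fun w => F w e) /\
       (\int[P]_w ((`|F w e| `^ (n%:R + alpha))%:E) < +oo)%E) /\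
  (forall e, (\int[P]_w ((F w e)%:E) = 0)%E) /\
  {ae P, forall w, forall (x0 : 'I_n -> int) (s : seq (dir n)),
      endpt x0 s = x0 -> path_sum T F w x0 s = 0}.

Definition qlogqp (R : realType) (q p : R) : \bar R :=
  if q == 0 then 0%E else if p == 0 then +oo%E else (q * ln (q / p))%:E.

Definition transition (R : realType) (dd : measure_display)
  (Om : measurableType dd) (n : nat) (q : Om -> dir n -> R) : Prop :=
  (forall e, measurable_fun setT (fun w => q w e)) /\
  (forall w e, 0 <= q w e <= 1) /\
  (forall w, \sum_(e : dir n) q w e = 1).

Definition density (R : realType) (dd : measure_display)
  (Om : measurableType dd) (P : probability Om R) (phi : Om -> R) : Prop :=
  measurable_fun setT phi /\ (forall w, 0 <= phi w) /\
  (\int[P]_w (phi w)%:E = 1)%E.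

Definition bounded_measurable (R : realType) (dd : measure_display)
  (Om : measurableType dd) (h : Om -> R) : Prop :=
  measurable_fun setT h /\ exists M : R, forall w, `|h w| <= M.

Definition Jfun (R : realType) (dd : measure_display)
  (Om : measurableType dd) (P : probability Om R) (n : nat)
  (T : dir n -> Om -> Om) (p : Om -> dir n -> R) (lam : 'I_n -> R)
  (q : Om -> dir n -> R) (phi : Om -> R) (h : Om -> R) : \bar R :=
  (\int[P]_w (\sum_(e : dir n)
      (((ip lam e + h w - h (T e w)) * q w e * phi w)%:E
       - qlogqp (q w e) (p w e) * (phi w)%:E)))%E.

Definition Gamma (R : realType) (dd : measure_display)
  (Om : measurableType dd) (P : probability Om R) (n : nat)
  (T : dir n -> Om -> Om) (p : Om -> dir n -> R) (lam : 'I_n -> R) : \bar R :=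
  ereal_sup [set ereal_inf [set Jfun P T p lam qphi.1 qphi.2 h | h in
                               [set h | bounded_measurable h]]
            | qphi in [set qphi : (Om -> dir n -> R) * (Om -> R) |
                         transition qphi.1 /\ density P qphi.2]].

(* Main.v *)
(** For bounded [h] write
    [grad h (w, e) = h w - h (T_e w)] and
    [X(h) = (log sum_e p e^(<lambda, e> + grad h) - a)^+], with
    [Gamma(lambda) < a], and minimize the convex functional
    [energy h = E (X(h)^2)].  Since [grad h] changes sign when an edge is
    reversed, a bound on [X(h)] together with the integrability of [log p] bounds
    [grad h] from both sides, in a weighted [L^2] space whose weight also embeds
    it in [L^1].  By the parallelogram identity a minimizing sequence can be
    chosen with summable [L^1] increments, so that its gradients converge almost
    surely, dominated by an integrable function, to a field [F]; loop sums and
    means vanish in the limit.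
    If [X(F) > 0] with positive probability, the stationarity of [F] says that
    [phi ~ X(F)] and [q ~ p e^(<lambda, .> + F)] satisfy
    [E (phi sum_e q (F - grad h)) <= 0] for all bounded [h]; this is exactly what
    makes the value of [(q, phi)] in the definition of [Gamma] at least [a], a
    contradiction.  Hence [X(F) = 0], which in turn bounds [F] by [log p] and
    gives its moment of order [d + alpha]. *)

Require Import Defs.
From HB Require Import structures.
From mathcomp Require Import all_boot all_order all_algebra.
From mathcomp Require Import all_classical all_reals all_analysis ess_sup_inf.
From mathcomp Require Import measurable_realfun.
From mathcomp Require Import ring lra zify.
Import Order.TTheory GRing.Theory Num.Theory.
Import numFieldNormedType.Exports.
Set Implicit Arguments. Unset Strict Implicit. Unset Printing Implicit Defensive.
Local Open Scope classical_set_scope.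
Local Open Scope ring_scope.

(** Reduces limits of positive parts to the continuity of the absolute value. *)
Lemma maxr0E (R : realType) (r : R) : Num.max r 0 = 2^-1 * (r + `|r|).
Proof.
by case: (leP r 0) => r0; [rewrite ler0_norm|rewrite gtr0_norm]; lra.
Qed.

(** * Convexity of log-sum-exp and of its squared excess over a level *)

Section LogSumExp.
Variables (R : realType) (I : finType).
Implicit Types (p x y z : I -> R) (a : R).

Definition expsum p x := \sum_i p i * expR (x i).
Definition lse p x := ln (expsum p x).
Definition gibbs p x i := p i * expR (x i) / expsum p x.
Definition excess a p x := Num.max (lse p x - a) 0.

Definition weights p := (forall i, 0 <= p i <= 1) /\ \sum_i p i = 1.

Lemma expsum_gt0 p x : weights p -> 0 < expsum p x.
Proof.
move=> [p01 p1].
have [i pi0] : exists i, 0 < p i.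
  apply: contrapT => /forallNP np; move: p1; rewrite big1 => [/eqP|i _].
    by rewrite eq_sym oner_eq0.
  by apply/eqP; rewrite eq_le (andP (p01 i)).1 andbT leNgt; apply/negP/np.
rewrite /expsum (bigD1 i)//= ltr_pwDl ?mulr_gt0 ?expR_gt0//.
by apply: sumr_ge0 => j _; rewrite mulr_ge0 ?expR_ge0// (andP (p01 j)).1.
Qed.

Lemma expR_lse p x : weights p -> expR (lse p x) = expsum p x.
Proof. by move=> wp; rewrite lnK// posrE expsum_gt0. Qed.

Lemma gibbs_weights p x : weights p -> weights (gibbs p x).
Proof.
move=> wp; have S0 := expsum_gt0 x wp; have [p01 p1] := wp; split=> [i|].
  have t0 j : 0 <= p j * expR (x j).
    by rewrite mulr_ge0 ?expR_ge0// (andP (p01 j)).1.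
  rewrite /gibbs divr_ge0 ?(ltW S0)//= ler_pdivrMr// mul1r /expsum (bigD1 i)//=.
  by rewrite lerDl sumr_ge0.
by rewrite /gibbs -mulr_suml divff// gt_eqF.
Qed.

Lemma weights_wavg_le p x (b : R) :
  weights p -> (forall i, x i <= b) -> \sum_i p i * x i <= b.
Proof.
move=> [p01 p1] xb; rewrite -[leRHS]mul1r -p1 mulr_suml; apply: ler_sum => i _.
by apply: ler_wpM2l => //; rewrite (andP (p01 i)).1.
Qed.

(* Jensen's inequality: it makes [lse] convex with gradient [gibbs]. *)
Lemma wavg_le_lse p x : weights p -> \sum_i p i * x i <= lse p x.
Proof.
move=> wp; have [p01 p1] := wp; set m := (\sum_i _).
rewrite -ler_expR expR_lse//.
(* The right side averages the tangent line of [expR] at the mean [m]; its linear part averages to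
   0. *)
have -> : expR m = \sum_i p i * (expR m * (1 + (x i - m))).
  under eq_bigr do rewrite mulrDr mulr1 mulrDr mulrCA.
  rewrite big_split/= -mulr_suml p1 mul1r -mulr_sumr.
  have -> : \sum_i p i * (x i - m) = 0.
    under eq_bigr do rewrite mulrBr.
    by rewrite sumrB -mulr_suml p1 mul1r subrr.
  by rewrite mulr0 addr0.
apply: ler_sum => i _; apply: ler_wpM2l; first by rewrite (andP (p01 i)).1.
have -> : expR (x i) = expR m * expR (x i - m) by rewrite -expRD addrC subrK.
by rewrite ler_wpM2l ?expR_ge0// expR_ge1Dx.
Qed.

(** Passing from [x] to [y] replaces [p] by its Gibbs weights: [lse p y - lse p x] is the
    log-sum-exp of [y - x] under [gibbs p x], to which Jensen's inequality applies. *)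
Lemma lse_grad p x y : weights p ->
  lse p x + \sum_i gibbs p x i * (y i - x i) <= lse p y.
Proof.
move=> wp; have wq := gibbs_weights x wp.
have S0 := expsum_gt0 x wp.
have -> : lse p y = lse p x + lse (gibbs p x) (fun i => y i - x i).
  rewrite -[in RHS]lnM ?posrE ?expsum_gt0//; congr ln.
  rewrite [in X in _ * X]/expsum /gibbs mulr_sumr; apply: eq_bigr => i _.
  by rewrite expRB; field; rewrite !gt_eqF ?expR_gt0.
by rewrite lerD2l wavg_le_lse.
Qed.

(** One term of the sum is at most the whole; a bound on [lse] thereby becomes an upper bound on
    each coordinate. *)
Lemma lse_ge p x i : weights p -> 0 < p i -> ln (p i) + x i <= lse p x.
Proof.
move=> wp pi0; have [p01 _] := wp.
rewrite -ler_expR expR_lse// expRD lnK ?posrE// /expsum (bigD1 i)//= lerDl.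
by apply: sumr_ge0 => j _; rewrite mulr_ge0 ?expR_ge0// (andP (p01 j)).1.
Qed.

Lemma lse_le p x (b : R) : weights p -> (forall i, x i <= b) -> lse p x <= b.
Proof.
move=> wp xb; rewrite -ler_expR expR_lse//.
by apply: weights_wavg_le => // i; rewrite ler_expR.
Qed.

Lemma lse_le_norm p x : weights p -> lse p x <= \sum_i `|x i|.
Proof.
move=> wp; apply: lse_le => // i.
by rewrite (bigD1 i)//= (le_trans (ler_norm _))// lerDl sumr_ge0.
Qed.

Lemma excess_ge0 a p x : 0 <= excess a p x.
Proof. by rewrite /excess le_max lexx orbT. Qed.

Lemma lse_le_excess a p x : lse p x <= a + excess a p x.
Proof. by rewrite -lerBlDl /excess le_max lexx. Qed.

Lemma excess_gt0 a p x : 0 < excess a p x -> excess a p x = lse p x - a.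
Proof. by rewrite /excess; case: (leP (lse p x - a) 0) => //; rewrite ltxx. Qed.

Lemma excess_le_norm a p x : weights p ->
  excess a p x <= `|a| + \sum_i `|x i|.
Proof.
move=> wp; rewrite /excess ge_max addr_ge0 ?sumr_ge0// andbT [leRHS]addrC lerD//.
  exact: lse_le_norm.
by rewrite -normrN ler_norm.
Qed.

(** The square of a nonnegative convex function is convex; this is its tangent inequality at [x]. *)
Lemma excess_sqr_grad a p x y : weights p ->
  excess a p x ^+ 2 + 2 * (excess a p x * \sum_i gibbs p x i * (y i - x i))
  <= excess a p y ^+ 2.
Proof.
move=> wp; have := lse_grad x y wp; have := excess_ge0 a p y.
have := lse_le_excess a p y.
set s := \sum_i _; set v := excess a p y.
move: (excess_ge0 a p x); rewrite le_eqVlt => /predU1P[<- *|u0].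
  by rewrite mul0r mulr0 addr0 expr0n/= sqr_ge0.
have := excess_gt0 u0; set u := excess a p x in u0 * => uE lv v0 ls.
have h : u + s <= v by lra.
(* The claim follows from [v^2 - u^2 - 2 u s = (v - u)^2 + 2 u (v - u - s)]. *)
have : 0 <= u * (v - u - s) by rewrite mulr_ge0 ?(ltW u0)//; lra.
have := sqr_ge0 (v - u); nra.
Qed.

(** With [s] the sum in the conclusion, convexity gives [(1 - t) s >= lse p x - lse p y], and
    [lse p x > a] because the excess is positive; the factor 2 comes from [1 - t >= 1/2]. The bound
    does not involve [z], so it can serve as a minorant along a sequence. *)
Lemma gibbs_slope_ge a p x y z (t b : R) : weights p -> 0 <= t <= 2^-1 ->
  (forall i, x i = (1 - t) * z i + t * y i) ->
  0 < excess a p x -> lse p y <= b -> 0 <= b ->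
  - (2 * (`|a| + b)) <= \sum_i gibbs p x i * (z i - y i).
Proof.
move=> wp /andP[t0 t12] xE X0 lyb b0; have XE := excess_gt0 X0.
have := lse_grad x y wp.
have -> : \sum_i gibbs p x i * (y i - x i) =
    - ((1 - t) * \sum_i gibbs p x i * (z i - y i)).
  rewrite mulr_sumr -sumrN; apply: eq_bigr => i _.
  by rewrite [in X in _ * X]xE; ring.
have := ler_norm a; have := ler_norm (- a); rewrite normrN.
set s := \sum_i _; have [s0|s0] := leP 0 s; first by lra.
have : (1 - t) * s <= s / 2 by nra.
lra.
Qed.

(** The tangent inequalities at the midpoint towards [x] and towards [y] have opposite linear terms,
    which cancel on averaging. *)
Lemma excess_sqr_mid a p x y : weights p ->
  excess a p (fun i => 2^-1 * (x i + y i)) ^+ 2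
  <= (excess a p x ^+ 2 + excess a p y ^+ 2) / 2.
Proof.
move=> wp; set z := fun i => _.
have := excess_sqr_grad a z x wp; have := excess_sqr_grad a z y wp.
set sy := \sum_i _; set sx := \sum_i _.
have -> : sy = - sx.
  rewrite /sx /sy -sumrN; apply: eq_bigr => i _; rewrite -[RHS]mulrN; congr (_ * _).
  by rewrite /z; lra.
by rewrite !mulrN; lra.
Qed.

Lemma cvg_expsum p (x : nat -> I -> R) (y : I -> R) :
  (forall i, x k i @[k --> \oo] --> y i) ->
  expsum p (x k) @[k --> \oo] --> expsum p y.
Proof.
move=> xy; rewrite /expsum; apply: cvg_big => [|i _]; last first.
  apply: cvgMl_tmp; apply: continuous_cvg (xy i); exact: continuous_expR.
by apply: add_continuous.
Qed.

Lemma cvg_lse p (x : nat -> I -> R) (y : I -> R) : weights p ->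
  (forall i, x k i @[k --> \oo] --> y i) ->
  lse p (x k) @[k --> \oo] --> lse p y.
Proof.
move=> wp xy; apply: continuous_cvg; last exact: cvg_expsum.
exact/continuous_ln/expsum_gt0.
Qed.

Lemma cvg_gibbs p (x : nat -> I -> R) (y : I -> R) i : weights p ->
  (forall i, x k i @[k --> \oo] --> y i) ->
  gibbs p (x k) i @[k --> \oo] --> gibbs p y i.
Proof.
move=> wp xy; apply: cvgM.
  apply: cvgMl_tmp; apply: continuous_cvg (xy i); exact: continuous_expR.
by apply: cvgV; rewrite ?gt_eqF ?expsum_gt0//; exact: cvg_expsum.
Qed.

Lemma cvg_excess a p (x : nat -> I -> R) (y : I -> R) : weights p ->
  (forall i, x k i @[k --> \oo] --> y i) ->
  excess a p (x k) @[k --> \oo] --> excess a p y.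
Proof.
move=> wp xy.
have cl : lse p (x k) - a @[k --> \oo] --> lse p y - a.
  by apply: cvgB; [exact: cvg_lse|exact: cvg_cst].
rewrite /excess maxr0E; under eq_cvg do rewrite maxr0E.
by apply: cvgMl_tmp; apply: cvgD; [exact: cl|apply: cvg_norm; exact: cl].
Qed.

End LogSumExp.

(** * Selecting minimizing sequences with small increments *)

Section NearMinimizers.
Variables (R : realType) (V : lmodType R) (D : set V) (B H : V -> R) (m C : R).

(* Nested convex sublevel sets of [B], on which the quadratic form [H] is
   almost minimized: the parallelogram identity makes the choices Cauchy. *)
Lemma near_minimizers :
  (forall u, 0 <= H u) ->
  (forall u v, D u -> D v -> D (2^-1 *: (u + v))) ->
  (forall d, 0 < d -> exists2 u, D u & B u <= m + d) ->
  (forall u v, D u -> D v -> B (2^-1 *: (u + v)) <= (B u + B v) / 2) ->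
  (forall u v, D u -> D v ->
     H (u - v) + 4 * H (2^-1 *: (u + v)) = 2 * (H u + H v)) ->
  (forall u, D u -> B u <= m + 1 -> H u <= C) ->
  forall e : nat -> R, (forall k, 0 < e k <= 1) ->
  exists u : nat -> V, forall k,
    [/\ D (u k), B (u k) <= m + e k & H (u k.+1 - u k) <= e k].
Proof.
move=> H0 Dmid Binf Bmid Hpar HC e e01.
pose K d := [set u | D u /\ B u <= m + d].
(* The supremum [eta] of these lower bounds is the limit of the infimum of [H] over [K d] as [d]
   decreases to 0; the condition [d <= 1] keeps [Y] below [C]. *)
pose Y := [set y | exists2 d, 0 < d <= 1 & forall u, K d u -> y <= H u].
have e0 k : 0 < e k by case/andP: (e01 k).
have [u1 Du1 Bu1] := Binf 1 ltr01.
have Y0 : Y 0 by exists 1 => // ; rewrite ltr01 lexx.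
have ubY : ubound Y C.
  move=> y [d /andP[d0 d1] yH]; have [u Du Bu] := Binf d d0.
  by apply: le_trans (yH u _) (HC u Du _) => //; rewrite (le_trans Bu)// lerD2l.
have supY : has_sup Y by split; [exists 0|exists C].
set eta := sup Y.
have lo t : 0 < t -> exists2 d, 0 < d & forall u, K d u -> eta - t <= H u.
  move=> t0; have [y [d /andP[d0 _] yH] yt] := sup_adherent t0 supY.
  by exists d => // u /yH; apply: le_trans; exact: ltW.
have hi t d : 0 < t -> 0 < d -> exists2 u, K d u & H u <= eta + t.
  move=> t0 d0; apply: contrapT => /forall2NP no.
  suff : Y (eta + t) by move/(ub_le_sup supY.2); rewrite -/eta; lra.
  exists (Num.min d 1) => [|u [Du Bu]].
    by rewrite lt_min d0 ltr01 ge_min lexx orbT.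
  have [nK|/negP] := no u; last by rewrite -ltNge => /ltW.
  by case: nK; split=> //; rewrite (le_trans Bu)// lerD2l ge_min lexx.
have /choice[d dP] : forall k, exists d, 0 < d /\
    forall u, K d u -> eta - e k / 8 <= H u.
  move=> k; have [|d] := lo (e k / 8); first by have := e0 k; lra.
  by exists d.
(* The entry [d k.-1] puts [u k.+1] into [K (d k)] as well, hence also its midpoint with [u k]. *)
pose r k := Num.min (e k) (Num.min (d k) (d k.-1)).
have r0 k : 0 < r k by rewrite /r !lt_min e0 !(dP _).1.
have /choice[u uP] : forall k, exists u, K (r k) u /\
    H u <= eta + Num.min (e k) (e k.-1) / 8.
  move=> k; have t0 : 0 < Num.min (e k) (e k.-1) / 8.
    by rewrite divr_gt0// lt_min !e0.
  by have [u] := hi _ _ t0 (r0 k); exists u.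
have KW x y v : x <= y -> K x v -> K y v.
  by move=> xy [Dv Bv]; split=> //; rewrite (le_trans Bv)// lerD2l.
exists u => k; have [[Du Bu] Hu] := uP k; split=> //.
  by rewrite (le_trans Bu)// lerD2l /r ge_min lexx.
have [[Du' Bu'] Hu'] := uP k.+1.
have Ku : K (d k) (u k) by apply: KW (uP k).1; rewrite /r !ge_min lexx !orbT.
have Ku' : K (d k) (u k.+1).
  by apply: KW (uP k.+1).1; rewrite /r/= !ge_min lexx !orbT.
(* As [H <= eta + e k / 8] at both ends, the parallelogram identity leaves at most [4 (eta + e k /
   8) - 4 (eta - e k / 8) = e k]. *)
have /(dP k).2 Hm : K (d k) (2^-1 *: (u k.+1 + u k)).
  split; first exact: Dmid.
  by apply: le_trans (Bmid _ _ Du' Du) _; case: Ku Ku' => _ b [_ b']; lra.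
have l1 : Num.min (e k) (e k.-1) <= e k by rewrite ge_min lexx.
have l2 : Num.min (e k.+1) (e k) <= e k by rewrite ge_min lexx orbT.
have := Hpar _ _ Du' Du; move: Hu' => /= Hu'; lra.
Qed.

End NearMinimizers.

(** * Integrals of real functions under a probability measure *)

Section RealIntegral.
Variables (R : realType) (d : measure_display) (Om : measurableType d).
Variable (P : probability Om R).
Implicit Types (f g : Om -> R).

Local Notation integ f := (P.-integrable setT (EFin \o f)).

Lemma integ_measurable f : integ f -> measurable_fun setT f.
Proof. by move=> /(measurable_int P)/measurable_EFinP. Qed.

Lemma integ_bounded f (M : R) :
  measurable_fun setT f -> (forall w, `|f w| <= M) -> integ f.
Proof.
move=> mf fM; apply: measurable_bounded_integrable => //.
  by rewrite -ge0_fin_numE//; exact: fin_num_measure.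
exists M; split; first exact: num_real.
by move=> x Mx w _ /=; rewrite (le_trans (fM w))// ltW.
Qed.

Lemma integ_ae_le f g : measurable_fun setT f -> integ g ->
  {ae P, forall w, `|f w| <= g w} -> integ f.
Proof.
move=> mf ig fg; apply/integrableP; split; first exact/measurable_EFinP.
have /integrableP[mg] := ig; apply: le_lt_trans.
apply: ae_ge0_le_integral => //.
- by apply: measurableT_comp => //; exact/measurable_EFinP.
- exact: measurableT_comp.
- apply: filterS fg => w fgw _ /=.
  by rewrite lee_fin (le_trans fgw)// ler_norm.
Qed.

Lemma integ_le f g : measurable_fun setT f -> integ g ->
  (forall w, `|f w| <= g w) -> integ f.
Proof. by move=> mf ig fg; apply: integ_ae_le ig _ => //; exact: aeW. Qed.

Lemma integD f g : integ f -> integ g -> integ (fun w => f w + g w).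
Proof. by move=> fi gi; exact: (integrableD measurableT fi gi). Qed.

Lemma integB f g : integ f -> integ g -> integ (fun w => f w - g w).
Proof. by move=> fi gi; exact: (integrableB measurableT fi gi). Qed.

Lemma integZ (c : R) f : integ f -> integ (fun w => c * f w).
Proof. by move=> fi; exact: (integrableZl measurableT c fi). Qed.

Lemma integ_cst (c : R) : integ (fun=> c).
Proof. by apply: (@integ_bounded _ `|c|) => //; exact: measurable_cst. Qed.

Lemma integ_powR f (s : R) : measurable_fun setT f ->
  (\int[P]_w (`|f w| `^ s)%:E < +oo)%E -> integ (fun w => `|f w| `^ s).
Proof.
move=> mf fs; apply/integrableP; split.
  apply/measurable_EFinP; apply: (measurableT_comp (measurable_powR s)).
  exact: measurableT_comp.
by under eq_integral do rewrite gee0_abs ?lee_fin ?powR_ge0//.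
Qed.

Lemma integ_of_moment f (s : R) : 1 <= s -> measurable_fun setT f ->
  integ (fun w => `|f w| `^ s) -> integ f.
Proof.
move=> s1 mf fs; apply: (@integ_le _ (fun w => 1 + `|f w| `^ s)) => //.
  by apply: integD => //; exact: integ_cst.
move=> w; have [f1|/ltW f1] := leP `|f w| 1.
  by rewrite (le_trans f1)// lerDl powR_ge0.
by rewrite -[leLHS]powRr1// (le_trans (ler_powR f1 s1))// lerDr.
Qed.

Lemma integ_sum (I : finType) (f : I -> Om -> R) :
  (forall i, integ (f i)) -> integ (fun w => \sum_i f i w).
Proof.
move=> fi; have := @integrable_sum _ _ _ P _ measurableT _ (index_enum I) xpredT
  (fun i => EFin \o f i) (fun i _ => fi i).
by congr (P.-integrable _ _); apply/funext => w /=; rewrite sumEFin.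
Qed.

Lemma EFin_Rintegral f : integ f ->
  (\int[P]_w f w)%:E = (\int[P]_w (f w)%:E)%E.
Proof. by move=> fi; rewrite fineK//; exact: integrable_fin_num. Qed.

Lemma Rintegral_cst_prob (c : R) : \int[P]_w c = c.
Proof.
by rewrite Rintegral_cst// [X in fine X](_ : _ = 1%E) ?mulr1//; exact: probability_setT.
Qed.

Lemma ae_eq_Rintegral f g : measurable_fun setT f -> measurable_fun setT g ->
  {ae P, forall w, f w = g w} -> \int[P]_w f w = \int[P]_w g w.
Proof.
move=> mf mg fg; congr fine; apply: ae_eq_integral => //.
- exact/measurable_EFinP.
- exact/measurable_EFinP.
- by apply: filterS fg => w /= -> _.
Qed.

Lemma ae_le_Rintegral f g : integ f -> integ g ->
  {ae P, forall w, f w <= g w} -> \int[P]_w f w <= \int[P]_w g w.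
Proof.
move=> fi gi fg; have mf := integ_measurable fi; have mg := integ_measurable gi.
(* Replacing [f] by its minimum with [g] turns the almost sure inequality into a pointwise one. *)
have mh : measurable_fun setT (fun w => Num.min (f w) (g w)).
  exact: measurable_minr.
rewrite (@ae_eq_Rintegral f (fun w => Num.min (f w) (g w)))//; last first.
  by apply: filterS fg => w fgw; rewrite min_l.
apply: le_Rintegral => //; last by move=> w _; rewrite ge_min lexx orbT.
apply: (@integ_le _ (fun w => `|f w| + `|g w|)) => //.
  by apply: integD; exact: integrable_norm.
by move=> w; case: (leP (f w) (g w)) => _; rewrite ?lerDl ?lerDr.
Qed.

Lemma Rintegral_eq0_ae f : integ f -> (forall w, 0 <= f w) ->
  \int[P]_w f w = 0 -> {ae P, forall w, f w = 0}.
Proof.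
move=> fi f0 If0; have mf := integ_measurable fi.
have : (\int[P]_w `|(f w)%:E| = 0)%E.
  under eq_integral do rewrite gee0_abs ?lee_fin//.
  by rewrite -EFin_Rintegral// If0.
move/ae_eq_integral_abs => /(_ measurableT) h.
have /h : measurable_fun setT (EFin \o f) by exact/measurable_EFinP.
by apply: filterS => w /(_ Logic.I) [].
Qed.

(** Positive and negative parts are compared separately, so [v] may fail to be integrable. *)
Lemma le_integral_minorant f (v : Om -> \bar R) : integ f ->
  measurable_fun setT v -> {ae P, forall w, ((f w)%:E <= v w)%E} ->
  (\int[P]_w (f w)%:E <= \int[P]_w v w)%E.
Proof.
move=> fi mv fv; have mf := measurable_int P fi.
rewrite integralE [leRHS]integralE; apply: leeB.
- apply: ae_ge0_le_integral => //; try exact: measurable_funepos.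
  by apply: filterS fv => w fvw _; rewrite !funeposE ge_max !le_max fvw lexx orbT.
- apply: ae_ge0_le_integral => //; try exact: measurable_funeneg.
  apply: filterS fv => w fvw _.
  by rewrite !funenegE ge_max !le_max leeN2 fvw lexx orbT.
Qed.

(** Fatou's lemma with the integrable minorant [- G]: the bound on the integrals passes to the limit
    and yields its integrability too. *)
Lemma fatou_Rintegral (f : nat -> Om -> R) (F G : Om -> R) (c : R)
    (e : nat -> R) :
  (forall k, integ (f k)) -> integ G -> measurable_fun setT F ->
  {ae P, forall w, f k w @[k --> \oo] --> F w} ->
  {ae P, forall w, forall k, - G w <= f k w} ->
  (forall k, \int[P]_w f k w <= c + e k) -> e k @[k --> \oo] --> 0 ->
  integ F /\ \int[P]_w F w <= c.
Proof.
move=> fi Gi mF fF Gf fc e0.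
have mG := integ_measurable Gi.
(* Truncation at 0 gives functions nonnegative everywhere and changes [f k + G] only on a null
   set. *)
pose u k w := Num.max (f k w + G w) 0.
pose U w := Num.max (F w + G w) 0.
have mf k := integ_measurable (fi k).
have mu k : measurable_fun setT (u k).
  by apply: measurable_maxr => //; apply: measurable_funD.
have mU : measurable_fun setT U.
  by apply: measurable_maxr => //; apply: measurable_funD.
have u0 k w : 0 <= u k w by rewrite le_max lexx orbT.
have U0 w : 0 <= U w by rewrite le_max lexx orbT.
have iu k : \int[P]_w u k w = \int[P]_w f k w + \int[P]_w G w.
  rewrite -RintegralD//; apply: ae_eq_Rintegral => //.
    exact: measurable_funD.
  apply: filterS Gf => w /(_ k) h; rewrite /u max_l//; lra.
have ui k : integ (u k).
  apply: integ_ae_le (integD (fi k) Gi) _ => //.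
  apply: filterS Gf => w /(_ k) h.
  by rewrite /u max_l ?ger0_norm//; lra.
have UF : {ae P, forall w, U w = F w + G w}.
  apply: filterS2 fF Gf => w fw Gw; rewrite /U max_l//.
  suff : - G w <= F w by lra.
  rewrite -(cvg_lim _ fw)//; apply: limr_ge; first exact: cvgP fw.
  by near=> k; exact: Gw.
have IU : (\int[P]_w (U w)%:E <= (c + \int[P]_w G w)%:E)%E.
  have -> : (\int[P]_w (U w)%:E = \int[P]_w limn_einf (fun k => (u k w)%:E))%E.
    apply: ae_eq_integral => //; first exact/measurable_EFinP.
      rewrite (_ : (fun _ => _) = (fun w => - limn_esup (fun k => - (u k w)%:E)))%E.
        apply: measurableT_comp => //; apply: measurable_fun_limn_esup => k.
        by apply: measurableT_comp => //; exact/measurable_EFinP.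
      by apply/funext => w; rewrite -limn_einfN; congr limn_einf;
        apply/funext => k; rewrite /= opprK.
    apply: filterS fF => w fw _.
    suff cu : (u k w)%:E @[k --> \oo] --> (U w)%:E.
      by rewrite (cvg_limn_einf_sup cu).1.
    apply: cvg_EFin; first by near=> k.
    rewrite /u /U maxr0E; under eq_cvg do rewrite /= maxr0E.
    have h : f k w + G w @[k --> \oo] --> F w + G w.
      by apply: cvgD => //; exact: cvg_cst.
    by apply: cvgMl_tmp; apply: cvgD; [exact: h|apply: cvg_norm; exact: h].
  apply: le_trans (fatou P measurableT _ _) _ => [k|k w _|].
  - exact/measurable_EFinP.
  - by rewrite lee_fin.
  - have -> : (fun k => \int[P]_x (u k x)%:E)%E =
              EFin \o (fun k => \int[P]_w u k w).
      by apply/funext => k /=; rewrite -EFin_Rintegral.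
    have : (c + e k + \int[P]_w G w)%:E @[k --> \oo] --> (c + \int[P]_w G w)%:E.
      apply: cvg_EFin; first by near=> k.
      apply: cvgD; last exact: cvg_cst.
      by rewrite -[X in _ --> X]addr0; apply: cvgD => //; exact: cvg_cst.
    move=> cv; rewrite -(cvg_lim _ cv)// limn_einf_lim.
    apply: lee_lim; [exact: is_cvg_einfs|exact: cvgP cv|near=> k].
    apply: (@le_trans _ _ (\int[P]_w u k w)%:E).
      by apply: ereal_inf_lbound; exists k => /=.
    by rewrite lee_fin iu lerD2r.
have iU : integ U.
  apply/integrableP; split; first exact/measurable_EFinP.
  under eq_integral do rewrite /= ger0_norm//.
  by rewrite (le_lt_trans IU)// ltry.
have iF : integ F.
  apply: integ_ae_le (integD iU (integrable_norm Gi)) _ => //.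
  apply: filterS UF => w UE; rewrite -[F w](addrK (G w)) -UE.
  by rewrite (le_trans (ler_normB _ _))// lerD2r ger0_norm.
split=> //; rewrite -(lerD2r (\int[P]_w G w)) -RintegralD//.
rewrite -lee_fin; apply: le_trans IU; rewrite -EFin_Rintegral// lee_fin.
by rewrite (ae_eq_Rintegral _ _ UF)//; exact: measurable_funD.
Unshelve. all: by end_near. Qed.

End RealIntegral.

(** * Invariance of integrals and of null sets under a measure-preserving map *)

Section MeasurePreserving.
Variables (R : realType) (d : measure_display) (Om : measurableType d).
Variables (P : probability Om R) (S : Om -> Om).
Hypothesis mS : measurable_fun setT S.
Hypothesis PS : forall A, measurable A -> P (S @^-1` A) = P A.

Local Notation integ f := (P.-integrable setT (EFin \o f)).

Lemma ge0_integral_comp (f : Om -> \bar R) : measurable_fun setT f ->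
  (forall w, 0 <= f w)%E -> (\int[P]_w f (S w) = \int[P]_w f w)%E.
Proof.
move=> mf f0.
rewrite -[RHS](@eq_measure_integral _ _ _ setT P (pushforward P S)) //.
  by rewrite ge0_integral_pushforward// => y _; exact: f0.
by move=> A mA _; exact: PS.
Qed.

Lemma integ_comp (f : Om -> R) : integ f -> integ (fun w => f (S w)).
Proof.
move=> fi; have mf := integ_measurable fi.
apply/integrableP; split; first by apply/measurable_EFinP; exact: measurableT_comp.
rewrite (ge0_integral_comp (f := fun w => `|(f w)%:E|%E))//.
  by have /integrableP[] := fi.
by apply: measurableT_comp => //; exact/measurable_EFinP.
Qed.

Lemma Rintegral_comp (f : Om -> R) : integ f ->
  \int[P]_w f (S w) = \int[P]_w f w.
Proof.
move=> fi; congr fine.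
rewrite -[RHS](@eq_measure_integral _ _ _ setT P (pushforward P S)) //.
  rewrite integral_pushforward//; last exact: (integ_comp fi).
  exact: (measurable_int P fi).
by move=> A mA _; exact: PS.
Qed.

Lemma ae_comp (Q : Om -> Prop) :
  {ae P, forall w, Q w} -> {ae P, forall w, Q (S w)}.
Proof.
move=> [N [mN N0 QN]]; exists (S @^-1` N); split.
- by rewrite -[X in measurable X]setTI; exact: mS.
- by rewrite PS.
- by move=> w /= nQ; exact: QN.
Qed.

End MeasurePreserving.

(** * Almost sure dominated convergence from summable increments *)

Section AELimit.
Variables (R : realType) (d : measure_display) (Om : measurableType d).
Variable (P : probability Om R).

Local Notation integ f := (P.-integrable setT (EFin \o f)).

(** The sum [Y] of the absolute increments has a finite integral, hence is finite almost surely;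
    there the telescoping series converges absolutely, and [|g 0| + Y] dominates the sequence. *)
Lemma ae_cvg_of_summable (g : nat -> Om -> R) (C : R) :
  (forall k, integ (g k)) ->
  (forall k, \int[P]_w `|g k.+1 w - g k w| <= C * 2^-1 ^+ k) ->
  exists F G : Om -> R, [/\ measurable_fun setT F, integ G,
    {ae P, forall w k, `|g k w| <= G w} &
    {ae P, forall w, g k w @[k --> \oo] --> F w}].
Proof.
move=> gi gC.
have mg k := integ_measurable (gi k).
pose u k w := g k.+1 w - g k w.
have ui k : integ (u k) by exact: integB.
have mu k := integ_measurable (ui k).
pose Y w := (\sum_(0 <= k <oo) `|u k w|%:E)%E.
have mau k : measurable_fun setT (fun w => `|u k w|%:E).
  by apply/measurable_EFinP; exact: measurableT_comp.
have mY : measurable_fun setT Y by apply: ge0_emeasurable_sum.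
have Y0 w : (0 <= Y w)%E by exact: nneseries_ge0.
have IY : (\int[P]_w Y w < +oo)%E.
  rewrite integral_nneseries//.
  apply: (@le_lt_trans _ _ (2 * C)%:E); last exact: ltry.
  apply: lime_le; first by apply: is_cvg_nneseries => k _ _; exact: integral_ge0.
  apply: nearW => n.
  rewrite (eq_bigr (fun k => (\int[P]_w `|u k w|)%:E)); last first.
    by move=> k _; rewrite EFin_Rintegral//; exact: integrable_norm.
  rewrite sumEFin lee_fin (le_trans (ler_sum _ (fun k _ => gC k)))//.
  have C0 : 0 <= C.
    by have := gC 0; rewrite expr0 mulr1; apply: le_trans; exact: Rintegral_ge0.
  have -> : \sum_(0 <= k < n) C * 2^-1 ^+ k = 2 * C * (1 - 2^-1 ^+ n).
    elim: n => [|n IH]; first by rewrite big_geq // expr0 subrr mulr0.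
    by rewrite big_nat_recr//= IH exprS; field.
  by rewrite ler_piMr ?mulr_ge0// gerBl exprn_ge0.
have iY : P.-integrable setT Y.
  apply/integrableP; split=> //.
  by under eq_integral do rewrite gee0_abs//.
have Yfin : {ae P, forall w, Y w \is a fin_num}.
  by apply: filterS (integrable_ae measurableT iY) => w; exact.
pose fins := [set w | Y w \is a fin_num].
have mO : measurable fins by rewrite -[fins]setTI; exact: emeasurable_fin_num.
(* Setting the sequence to 0 where [Y] is infinite makes it converge everywhere, so its limit is
   measurable. *)
pose h k w := g k w * (\1_fins w).
have hP w : fins w -> forall k, h k w = g k w.
  by move=> Ow k; rewrite /h indicE mem_set// mulr1.
have hN w : ~ fins w -> forall k, h k w = 0.
  by move=> Ow k; rewrite /h indicE memNset// mulr0.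
have gs w n : g n w = g 0 w + \sum_(0 <= k < n) u k w.
  by rewrite telescope_sumr// addrC subrK.
have cg w : fins w -> cvgn (g ^~ w).
  move=> Ow; rewrite (_ : g ^~ w = fun n => g 0 w + series (u ^~ w) n); last first.
    by apply/funext => n; rewrite {1}gs.
  apply: is_cvgD; first exact: is_cvg_cst.
  apply: normed_cvg; apply: nondecreasing_is_cvgn.
    by apply/nondecreasing_seqP => n; rewrite /= /series/= big_nat_recr//= lerDl.
  exists (fine (Y w)) => _ [n _ <-] /=.
  by rewrite -lee_fin fineK// /series/= -sumEFin; exact: nneseries_lim_ge.
pose F w := limn (h ^~ w).
have hF w : h k w @[k --> \oo] --> F w.
  have [Ow|nO] := pselect (fins w).
    rewrite /F (_ : h ^~ w = g ^~ w); first exact: cg.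
    by apply/funext => k; exact: hP.
  rewrite /F (_ : h ^~ w = fun=> 0); first exact: is_cvg_cst.
  by apply/funext => k; exact: hN.
exists F, (fun w => `|g 0 w| + fine (Y w)); split.
- apply: (measurable_fun_cvg (h := h)) => [k|w _]; last exact: hF.
  by apply: measurable_funM => //; exact: measurable_indic.
- apply: integD; first exact: integrable_norm (gi 0).
  apply/integrableP; split.
    by apply/measurable_EFinP; exact: measurableT_comp.
  apply: le_lt_trans IY; apply: ge0_le_integral => //.
    by apply: measurableT_comp => //; apply/measurable_EFinP; exact: measurableT_comp.
  by move=> w _ /=; rewrite ger0_norm ?fine_ge0//; case: (Y w) (Y0 w).
- apply: filterS Yfin => w Yw k; rewrite gs.
  rewrite (le_trans (ler_normD _ _))// lerD2l (le_trans (ler_norm_sum _ _ _))//.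
  rewrite -lee_fin fineK// -sumEFin; exact: nneseries_lim_ge.
- apply: filterS Yfin => w Yw; have := hF w.
  by rewrite (_ : h ^~ w = g ^~ w)//; apply/funext => k; exact: hP.
Qed.

End AELimit.

(** * The lattice action, gradients and sums along paths *)

Section LatticeAction.
Variables (Om : Type) (n : nat) (T : dir n -> Om -> Om).
Hypothesis Tcomm : forall e e', T e \o T e' = T e' \o T e.
Hypothesis Tinv : forall i : 'I_n,
  T (i, true) \o T (i, false) = id /\ T (i, false) \o T (i, true) = id.

Definition opp_dir (e : dir n) : dir n := (e.1, ~~ e.2).

Lemma opp_dirK e : T (opp_dir e) \o T e = id.
Proof. by case: e => i [] /=; rewrite /opp_dir/=; have [] := Tinv i. Qed.

Lemma opp_dir_cancel e w : T (opp_dir e) (T e w) = w.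
Proof. by have /(congr1 (fun f => f w)) := opp_dirK e. Qed.

Lemma Tpow_comm e i k w : Tpow T i k (T e w) = T e (Tpow T i k w).
Proof.
have tc e' v : T e' (T e v) = T e (T e' v).
  by have /(congr1 (fun f => f v)) := Tcomm e' e.
have it e' m : iter m (T e') (T e w) = T e (iter m (T e') w).
  by elim: m => //= m ->; rewrite tc.
by case: k => m; rewrite /Tpow it.
Qed.

Lemma Tpow_step e k w :
  Tpow T e.1 (k + (if e.2 then 1 else -1)) w = T e (Tpow T e.1 k w).
Proof.
have tf i v : T (i, false) (T (i, true) v) = v by exact: (opp_dir_cancel (i, true)).
have ft i v : T (i, true) (T (i, false) v) = v by exact: (opp_dir_cancel (i, false)).
case: e => i [].
  (* [Negz m] is [-(m + 1)]: a step up cancels one inverse in both negative cases, and leads from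
     [Negz 0] to [Posz 0]. *)
  case: k => [m|[|m]].
  - by rewrite (_ : Posz m + _ = Posz m.+1)//; lia.
  - by rewrite /= ft.
  - rewrite (_ : Negz m.+1 + _ = Negz m); last by rewrite /= !NegzE; lia.
    by rewrite /= ft.
case: k => [[|m]|m].
- by [].
- rewrite (_ : Posz m.+1 + _ = Posz m); last by rewrite /=; lia.
  by rewrite /= tf.
- by rewrite (_ : Negz m + _ = Negz m.+1)//= !NegzE; lia.
Qed.

(** [Tx] composes over distinct coordinates: only the factor of [e.1] gains a step, and the new
    [T e] commutes past the factors outside it. *)
Lemma Tx_step x e w : Tx T (fun j => x j + unitvec e j) w = T e (Tx T x w).
Proof.
rewrite /Tx; set G := fun y r => foldr (fun i f => Tpow T i (y i) \o f) id r.
have Gnotin (r : seq 'I_n) v : e.1 \notin r ->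
    G (fun j => x j + unitvec e j) r v = G x r v.
  elim: r => //= i r IH; rewrite inE negb_or => /andP[ei /IH ->].
  by rewrite /unitvec eq_sym (negbTE ei) addr0.
have Gin (r : seq 'I_n) v : uniq r -> e.1 \in r ->
    G (fun j => x j + unitvec e j) r v = T e (G x r v).
  elim: r => //= i r IH /andP[ir ur]; rewrite inE => /predU1P[ei|er].
    rewrite Gnotin ?ei// -/(G x r); rewrite -ei /unitvec eqxx.
    exact: Tpow_step.
  rewrite IH// -/(G x r) Tpow_comm /unitvec.
  have /negbTE -> : i != e.1 by apply: contraNneq ir => ->.
  by rewrite addr0.
by apply: Gin; [exact: enum_uniq|rewrite mem_enum].
Qed.

(** Words over [dir n] form a countable type, so almost sure statements along a whole orbit need
    only countably many null sets. *)
Lemma Tx_word x : exists s : seq (dir n), forall w, Tx T x w = foldr T w s.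
Proof.
have itw e m : exists s : seq (dir n), forall w, iter m (T e) w = foldr T w s.
  exists (nseq m e) => w; elim: m => //= m <-; exact.
have pw i k : exists s : seq (dir n), forall w, Tpow T i k w = foldr T w s.
  by case: k => m; exact: itw.
rewrite /Tx; elim: (enum 'I_n) => [|i r [s IH]]; first by exists [::].
have [s' IH'] := pw i (x i).
by exists (s' ++ s) => w; rewrite foldr_cat /= IH' IH.
Qed.

Variable R : realType.

Definition grad (h : Om -> R) (w : Om) (e : dir n) : R := h w - h (T e w).

(** The sum telescopes, since by [Tx_step] each step of the path acts by [T e]. *)
Lemma path_sum_grad h w x s :
  path_sum T (grad h) w x s = h (Tx T x w) - h (Tx T (endpt x s) w).
Proof.
elim: s x => [|e s IH] x /=.
  rewrite (_ : endpt x [::] = x) ?subrr//.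
  by apply/funext => j; rewrite /endpt big_nil addr0.
rewrite IH /grad -Tx_step (_ : endpt _ s = endpt x (e :: s)); first by ring.
by apply/funext => j; rewrite /endpt big_cons addrA.
Qed.

Lemma cvg_path_sum (g : nat -> Om -> dir n -> R) (F : Om -> dir n -> R) w :
  (forall (r : seq (dir n)) e,
     g k (foldr T w r) e @[k --> \oo] --> F (foldr T w r) e) ->
  forall x s, path_sum T (g k) w x s @[k --> \oo] --> path_sum T F w x s.
Proof.
move=> gF x s; elim: s x => [|e s IH] x /=; first exact: cvg_cst.
have [r ->] := Tx_word x.
by apply: cvgD; [exact: gF|exact: IH].
Qed.

Lemma grad_opp h w e : grad h (T e w) (opp_dir e) = - grad h w e.
Proof. by rewrite /grad opp_dir_cancel opprB. Qed.

End LatticeAction.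

(** * Countable families of almost sure events, and measurability of the log-sum-exp functions *)

Section AlmostEverywhere.
Variables (R : realType) (d : measure_display) (Om : measurableType d).
Variable (P : probability Om R).

Lemma ae_forall_count (I : countType) (Q : I -> Om -> Prop) :
  (forall i, {ae P, forall w, Q i w}) -> {ae P, forall w, forall i, Q i w}.
Proof.
move=> aeQ.
have /ae_foralln : forall k, {ae P, forall w,
    if @unpickle I k is Some i then Q i w else True}.
  by move=> k; case: unpickle => [i|]; [exact: aeQ|exact: aeW].
by apply: filterS => w + i => /(_ (pickle i)); rewrite pickleK.
Qed.

End AlmostEverywhere.

Lemma measurable_inv_pos (R : realType) (d : measure_display)
    (Om : measurableType d) (f : Om -> R) : measurable_fun setT f ->
  (forall w, 0 < f w) -> measurable_fun setT (fun w => (f w)^-1).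
Proof.
move=> mf f0; rewrite (_ : (fun w => _) = (fun w => expR (- ln (f w)))).
  apply: measurableT_comp => //; apply: measurableT_comp => //.
  exact: measurableT_comp.
by apply/funext => w; rewrite expRN lnK ?posrE.
Qed.

Section Measurability.
Variables (R : realType) (d : measure_display) (Om : measurableType d).
Variables (I : finType) (p x : Om -> I -> R).
Hypothesis mp : forall i, measurable_fun setT (p ^~ i).
Hypothesis wp : forall w, weights (p w).
Hypothesis mx : forall i, measurable_fun setT (x ^~ i).

Lemma measurable_expsum : measurable_fun setT (fun w => expsum (p w) (x w)).
Proof.
apply: measurable_sum => i; apply: measurable_funM => //.
exact: measurableT_comp.
Qed.

Lemma measurable_lse : measurable_fun setT (fun w => lse (p w) (x w)).
Proof. by apply: measurableT_comp => //; exact: measurable_expsum. Qed.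

Lemma measurable_excess (a : R) :
  measurable_fun setT (fun w => excess a (p w) (x w)).
Proof.
by apply: measurable_maxr => //; apply: measurable_funB => //; exact: measurable_lse.
Qed.

Lemma measurable_gibbs i : measurable_fun setT (fun w => gibbs (p w) (x w) i).
Proof.
apply: measurable_funM.
  by apply: measurable_funM => //; exact: measurableT_comp.
by apply: measurable_inv_pos => [|w]; [exact: measurable_expsum|exact: expsum_gt0].
Qed.

End Measurability.

(** * Tilted fields in the random environment *)

Section Environment.
Variables (R : realType) (dd : measure_display) (Om : measurableType dd).
Variables (P : probability Om R) (n : nat) (T : dir n -> Om -> Om).
Variables (p : Om -> dir n -> R) (lam : 'I_n -> R) (a : R).
Hypothesis Tcomm : forall e e', T e \o T e' = T e' \o T e.
Hypothesis Tinv : forall i : 'I_n,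
  T (i, true) \o T (i, false) = id /\ T (i, false) \o T (i, true) = id.
Hypothesis mT : forall e, measurable_fun setT (T e).
Hypothesis PT : forall e A, measurable A -> P (T e @^-1` A) = P A.
Hypothesis tp : transition p.
Hypothesis p_gt0 : {ae P, forall w, forall e, 0 < p w e}.
Hypothesis lnp : forall e, P.-integrable setT (fun w => (ln (p w e))%:E).

Local Notation integ f := (P.-integrable setT (EFin \o f)).
Implicit Types (h : Om -> R) (x y : Om -> dir n -> R).

Definition tilt (x : dir n -> R) (e : dir n) : R := ip lam e + x e.
Definition lseT x w := lse (p w) (tilt (x w)).
(** At [x = grad T h] this is the function [X(h)] whose square the energy integrates. *)
Definition exc x w := excess a (p w) (tilt (x w)).
Definition gibbsT x w e := gibbs (p w) (tilt (x w)) e.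

Let wp w : weights (p w).
Proof. by have [_ [p01 p1]] := tp. Qed.

Let mp e : measurable_fun setT (p ^~ e).
Proof. by have [] := tp. Qed.

Let mtilt x : (forall e, measurable_fun setT (x ^~ e)) ->
  forall e, measurable_fun setT (fun w => tilt (x w) e).
Proof. by move=> mx e; apply: measurable_funD. Qed.

Lemma measurable_lseT x : (forall e, measurable_fun setT (x ^~ e)) ->
  measurable_fun setT (lseT x).
Proof. by move=> mx; apply: measurable_lse => // e; exact: mtilt. Qed.

Lemma measurable_exc x : (forall e, measurable_fun setT (x ^~ e)) ->
  measurable_fun setT (exc x).
Proof. by move=> mx; apply: measurable_excess => // e; exact: mtilt. Qed.

Lemma measurable_gibbsT x : (forall e, measurable_fun setT (x ^~ e)) ->
  forall e, measurable_fun setT (fun w => gibbsT x w e).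
Proof. by move=> mx e; apply: measurable_gibbs => // e'; exact: mtilt. Qed.

Lemma gibbsT_transition x : (forall e, measurable_fun setT (x ^~ e)) ->
  transition (gibbsT x).
Proof.
move=> mx; split; first exact: measurable_gibbsT.
by split=> w; have [q01 q1] := gibbs_weights (tilt (x w)) (wp w).
Qed.

Definition expo : R := `|a| + \sum_e `|ip lam e|.

Lemma exc_le x w : exc x w <= expo + \sum_e `|x w e|.
Proof.
rewrite (le_trans (excess_le_norm _ _ (wp w)))// /expo -addrA lerD2l -big_split/=.
by apply: ler_sum => e _; exact: ler_normD.
Qed.

Lemma exc_ge0 x w : 0 <= exc x w. Proof. exact: excess_ge0. Qed.

Definition bfield x := forall e, measurable_fun setT (x ^~ e) /\
  exists M : R, forall w, `|x w e| <= M.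

Lemma bfield_bound x : bfield x -> exists M : R, forall w e, `|x w e| <= M.
Proof.
move=> bx; have /choice[M MP] e := (bx e).2.
exists (\sum_e `|M e|) => w e; rewrite (le_trans (MP e w))// (bigD1 e)//=.
by rewrite (le_trans (ler_norm _))// lerDl sumr_ge0.
Qed.

Lemma integ_exc_sqr x : bfield x -> integ (fun w => exc x w ^+ 2).
Proof.
move=> bx; have [M MP] := bfield_bound bx.
apply: (@integ_bounded _ _ _ _ _ ((expo + \sum_(e : dir n) M) ^+ 2)).
  by apply: measurable_funX; apply: measurable_exc => e; exact: (bx e).1.
move=> w; rewrite ger0_norm ?sqr_ge0// lerXn2r ?nnegrE ?exc_ge0//.
  by rewrite (le_trans (exc_ge0 x w))// (le_trans (exc_le x w))// lerD2l ler_sum.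
by rewrite (le_trans (exc_le x w))// lerD2l ler_sum.
Qed.

Lemma bfield_grad h : bounded_measurable h -> bfield (grad T h).
Proof.
move=> [mh [M hM]] e; split.
  by apply: measurable_funB => //; exact: measurableT_comp.
by exists (M + M) => w; rewrite (le_trans (ler_normB _ _))// lerD.
Qed.

Lemma bounded_measurable_lin (s t : R) h h' :
  bounded_measurable h -> bounded_measurable h' ->
  bounded_measurable (fun w => s * h w + t * h' w).
Proof.
move=> [mh [M hM]] [mh' [M' hM']]; split.
  by apply: measurable_funD; apply: measurable_funM.
exists (`|s| * M + `|t| * M') => w; rewrite (le_trans (ler_normD _ _))//.
by rewrite !normrM lerD// ler_wpM2l.
Qed.

(** * The energy, the weighted quadratic form, and coercivity *)

Definition energy h := \int[P]_w (exc (grad T h) w ^+ 2).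

(** The inverse of the weight in [qform]. It collects the constants of the upper bounds on the
    gradient at both ends of an edge; the summand 1 keeps it at least 1, and the integrability of
    [ln p] makes it integrable. *)
Definition ivar (e : dir n) w : R :=
  1 + `|a| + `|ip lam e| + `|ip lam (opp_dir e)| + `|ln (p w e)|
  + `|ln (p (T e w) (opp_dir e))|.

Lemma ivar_ge1 e w : 1 <= ivar e w.
Proof. by rewrite /ivar -!addrA lerDl !addr_ge0. Qed.

Lemma ivar_gt0 e w : 0 < ivar e w.
Proof. exact: lt_le_trans ltr01 (ivar_ge1 e w). Qed.

Lemma integ_ivar e : integ (ivar e).
Proof.
apply: integD; last first.
  apply: (integ_comp (mT e) (PT e) (f := fun w => `|ln (p w (opp_dir e))|)).
  exact: (integrable_norm (lnp _)).
apply: integD; last exact: (integrable_norm (lnp _)).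
exact: integ_cst.
Qed.

Lemma measurable_ivar e : measurable_fun setT (ivar e).
Proof. exact: integ_measurable (integ_ivar e). Qed.

Definition qform h := \sum_e \int[P]_w (grad T h w e ^+ 2 / ivar e w).

Lemma integ_qform e h : bounded_measurable h ->
  integ (fun w => grad T h w e ^+ 2 / ivar e w).
Proof.
move=> bh; have [mg [M gM]] := bfield_grad bh e.
apply: (@integ_bounded _ _ _ _ _ (M ^+ 2)).
  apply: measurable_funM; first exact: measurable_funX.
  by apply: measurable_inv_pos (measurable_ivar e) _ => w; exact: ivar_gt0.
move=> w; rewrite ger0_norm ?divr_ge0 ?sqr_ge0 ?(ltW (ivar_gt0 e w))//.
rewrite ler_pdivrMr ?ivar_gt0// (@le_trans _ _ (M ^+ 2))//.
  rewrite -[leLHS]ger0_norm ?sqr_ge0// normrX lerXn2r ?nnegrE//.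
  exact: le_trans (gM w).
by rewrite ler_peMr ?ivar_ge1// sqr_ge0.
Qed.

Lemma qform_ge0 h : 0 <= qform h.
Proof.
apply: sumr_ge0 => e _; apply: Rintegral_ge0 => w _.
by rewrite divr_ge0 ?sqr_ge0// ltW// ivar_gt0.
Qed.

Lemma gradB h h' w e : grad T (h - h') w e = grad T h w e - grad T h' w e.
Proof.
have E v : (h - h') v = h v - h' v by [].
by rewrite /grad !E; ring.
Qed.

Lemma grad_mid h h' w e :
  grad T (2^-1 *: (h + h')) w e = 2^-1 * (grad T h w e + grad T h' w e).
Proof.
have E v : (2^-1 *: (h + h')) v = 2^-1 * (h v + h' v) by [].
by rewrite /grad !E; ring.
Qed.

Lemma bounded_measurable_mid h h' :
  bounded_measurable h -> bounded_measurable h' ->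
  bounded_measurable (2^-1 *: (h + h')).
Proof.
move=> bh bh'; have := bounded_measurable_lin 2^-1 2^-1 bh bh'.
by congr bounded_measurable; apply/funext => w; rewrite -mulrDr.
Qed.

Lemma bounded_measurableB h h' :
  bounded_measurable h -> bounded_measurable h' -> bounded_measurable (h - h').
Proof.
move=> bh bh'; have := bounded_measurable_lin 1 (-1) bh bh'.
by congr bounded_measurable; apply/funext => w; rewrite mul1r mulN1r.
Qed.

Lemma qform_parallelogram h h' :
  bounded_measurable h -> bounded_measurable h' ->
  qform (h - h') + 4 * qform (2^-1 *: (h + h')) = 2 * (qform h + qform h').
Proof.
move=> bh bh'; have bm := bounded_measurable_mid bh bh'.
have bb := bounded_measurableB bh bh'.
rewrite /qform -big_split/= !mulr_sumr -big_split/=; apply: eq_bigr => e _.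
rewrite -RintegralZl//; last exact: integ_qform.
rewrite -!RintegralD//; [|exact: integ_qform..|exact: integZ (integ_qform e bm)].
rewrite -RintegralZl//; last by apply: integD; exact: integ_qform.
apply: eq_Rintegral => w _; rewrite gradB grad_mid; field.
by rewrite gt_eqF// ivar_gt0.
Qed.

Lemma energy_mid h h' : bounded_measurable h -> bounded_measurable h' ->
  energy (2^-1 *: (h + h')) <= (energy h + energy h') / 2.
Proof.
move=> bh bh'; have bm := bounded_measurable_mid bh bh'.
have i u (bu : bounded_measurable u) := integ_exc_sqr (bfield_grad bu).
rewrite /energy -RintegralD ?i// -RintegralZr//; last by apply: integD; exact: i.
apply: le_Rintegral => //; first exact: i.
  have := integZ 2^-1 (integD (i _ bh) (i _ bh')).
  by congr (P.-integrable _ _); apply/funext => w; rewrite /= mulrC.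
move=> w _; have := excess_sqr_mid a (tilt (grad T h w)) (tilt (grad T h' w)) (wp w).
rewrite /exc (_ : (fun i => _) = tilt (grad T (2^-1 *: (h + h')) w))//.
by apply/funext => e; rewrite /tilt grad_mid; field.
Qed.

(* The lower bound on a gradient is the upper bound at the other end of the
   edge, as [grad h (T e w) (- e) = - grad h w e]. *)
Lemma grad_abs_le : {ae P, forall w, forall h e,
  `|grad T h w e| <= exc (grad T h) w + exc (grad T h) (T e w) + ivar e w}.
Proof.
have upper w h e : 0 < p w e ->
    grad T h w e <= exc (grad T h) w + `|a| + `|ip lam e| + `|ln (p w e)|.
  move=> pe; have := lse_ge (tilt (grad T h w)) (wp w) pe.
  have := lse_le_excess a (p w) (tilt (grad T h w)).
  rewrite -/(exc (grad T h) w) /tilt.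
  have := ler_norm a; have := ler_norm (- ip lam e).
  by have := ler_norm (- ln (p w e)); rewrite !normrN; lra.
have /ae_forall_count p_gt0T : forall e, {ae P, forall w, forall e', 0 < p (T e w) e'}.
  by move=> e; exact: (ae_comp (mT e) (PT e) p_gt0).
apply: filterS2 p_gt0 p_gt0T => w pw pTw h e.
have := upper w h e (pw e).
have := upper (T e w) h (opp_dir e) (pTw e (opp_dir e)).
rewrite (grad_opp Tinv) ler_norml /ivar.
have := exc_ge0 (grad T h) w; have := exc_ge0 (grad T h) (T e w).
have := normr_ge0 a; have := normr_ge0 (ip lam e).
have := normr_ge0 (ip lam (opp_dir e)); have := normr_ge0 (ln (p w e)).
have := normr_ge0 (ln (p (T e w) (opp_dir e))).
by move=> *; apply/andP; split; lra.
Qed.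

(** Let [X], [Y] be the excesses at the two ends of an edge and [V] the value of [ivar]. The squared
    gradient is at most [3 (X^2 + Y^2 + V^2)]; division by [V >= 1] leaves [3 (X^2 + Y^2 + V)], and
    [X^2], [Y^2] have the same integral by invariance. This gives the 6 and the 3 in [C]. *)
Lemma qform_le : exists C, forall h, bounded_measurable h ->
  qform h <= C + C * energy h.
Proof.
pose C : R := \sum_(e : dir n) (6 + 3 * \int[P]_w ivar e w).
exists C => h bh.
have i := integ_exc_sqr (bfield_grad bh).
have B0 : 0 <= energy h by apply: Rintegral_ge0 => w _; exact: sqr_ge0.
rewrite /C mulr_suml -big_split/=; apply: ler_sum => e _.
have iT := integ_comp (mT e) (PT e) i.
have IV : 0 <= \int[P]_w ivar e w.
  by apply: Rintegral_ge0 => w _; exact: ltW (ivar_gt0 e w).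
apply: (@le_trans _ _ (3 * (energy h + energy h + \int[P]_w ivar e w))); last by nra.
rewrite -[X in _ * (_ + X + _)](Rintegral_comp (mT e) (PT e) i).
have iS := integD i iT; have iV := integ_ivar e.
rewrite -RintegralD// -RintegralD// -RintegralZl//; last exact: integD.
apply: ae_le_Rintegral; first exact: integ_qform.
  exact/integZ/integD.
apply: filterS grad_abs_le => w /(_ h e).
have V1 := ivar_ge1 e w; have V0 := ivar_gt0 e w.
set X := exc _ w; set Y := exc _ _; set V := ivar e w => gle.
rewrite ler_pdivrMr// -(@real_normK _ (grad T h w e)) ?num_real//.
have X0 : 0 <= X by exact: exc_ge0.
have Y0 : 0 <= Y by exact: exc_ge0.
apply: (@le_trans _ _ ((X + Y + V) ^+ 2)).
  by rewrite lerXn2r ?nnegrE// !addr_ge0// ltW.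
have := sqr_ge0 (X - Y); have := sqr_ge0 (X - V); have := sqr_ge0 (Y - V).
have : 0 <= (X ^+ 2 + Y ^+ 2) * (V - 1).
  by rewrite mulr_ge0 ?subr_ge0// addr_ge0 ?sqr_ge0.
by rewrite !expr2 => *; nra.
Qed.

(** * Minimizing sequences and their limit field *)

Lemma energy_ge0 h : 0 <= energy h.
Proof. by apply: Rintegral_ge0 => w _; exact: sqr_ge0. Qed.

(** The rate [4^-1 ^+ k] is the square of [2^-1 ^+ k]: it still leaves [2^-1 ^+ k] after
    multiplication by [K = 2 ^+ k] in the AM-GM bound, and after division by twice the step size in
    [limit_stationary]. *)
Lemma energy_minimizers : exists u : nat -> Om -> R, forall k,
  [/\ bounded_measurable (u k),
      forall h, bounded_measurable h -> energy (u k) <= energy h + 4^-1 ^+ k &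
      qform (u k.+1 - u k) <= 4^-1 ^+ k].
Proof.
pose E := [set energy h | h in [set h | bounded_measurable h]].
pose z : Om -> R := fun=> 0.
have b0 : bounded_measurable z.
  by split; [exact: measurable_cst|exists 0 => w; rewrite normr0].
have lbE : has_lbound E by exists 0 => _ [h _ <-]; exact: energy_ge0.
have infE : has_inf E by split=> //; exists (energy z); exists z.
have [C CP] := qform_le.
have C0 : 0 <= C.
  have := CP _ b0; have := qform_ge0 z; have := energy_ge0 z.
  by move=> *; nra.
have [||||||k|u uP] := @near_minimizers R (Om -> R) (bounded_measurable (Om := Om))
  energy qform (inf E) (C + C * (inf E + 1)) _ _ _ _ _ _ (fun k => 4^-1 ^+ k).
- exact: qform_ge0.
- exact: bounded_measurable_mid.
- move=> t t0; have [_ [h bh <-] hE] := inf_adherent t0 infE.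
  by exists h => //; exact: ltW.
- exact: energy_mid.
- exact: qform_parallelogram.
- move=> h bh Eh; rewrite (le_trans (CP _ bh))// lerD2l ler_wpM2l//.
- by rewrite exprn_gt0//= exprn_ile1//; lra.
exists u => k; have [bu Eu Qu] := uP k; split=> // h bh.
by rewrite (le_trans Eu)// lerD2r ge_inf//; exists h.
Qed.

(* AM-GM turns the weighted L^2 bound on the increments into an L^1 bound. *)
Lemma Rintegral_grad_le e h (K : R) : bounded_measurable h -> 0 < K ->
  \int[P]_w `|grad T h w e| <= (K * qform h + K^-1 * \int[P]_w ivar e w) / 2.
Proof.
move=> bh K0; have iq := integ_qform e bh.
apply: (@le_trans _ _ ((K * \int[P]_w (grad T h w e ^+ 2 / ivar e w)
    + K^-1 * \int[P]_w ivar e w) / 2)).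
  rewrite -!RintegralZl//; last exact: integ_ivar.
  have iV := integZ K^-1 (integ_ivar e).
  rewrite -RintegralD//; last exact: integZ.
  have iS := integD (integZ K iq) iV.
  rewrite -RintegralZr//; apply: le_Rintegral => //.
  - have [mg [M gM]] := bfield_grad bh e.
    by apply: integrable_norm => //; exact: integ_bounded gM.
  - have := integZ 2^-1 iS.
    by congr (P.-integrable _ _); apply/funext => w; rewrite /= mulrC.
  move=> w _; have V0 := ivar_gt0 e w; set V := ivar e w in V0 *.
  set g := `|_|; rewrite -(@real_normK _ (grad T h w e)) ?num_real// -/g.
  have KV : 0 < K / V by rewrite divr_gt0.
  have -> : K * (g ^+ 2 / V) + K^-1 * V =
            2 * g + (K / V) * (g - V / K) ^+ 2 by field; rewrite !gt_eqF.
  by have := mulr_ge0 (ltW KV) (sqr_ge0 (g - V / K)); lra.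
rewrite ler_wpM2r// lerD2r ler_wpM2l ?(ltW K0)// /qform (bigD1 e)//= lerDl.
apply: sumr_ge0 => e' _; apply: Rintegral_ge0 => w _.
by rewrite divr_ge0 ?sqr_ge0// ltW// ivar_gt0.
Qed.

Definition dominated_limit (u : nat -> Om -> R) (F G : Om -> dir n -> R) :=
  [/\ forall e, measurable_fun setT (F ^~ e), forall e, integ (G ^~ e),
      {ae P, forall w e k, `|grad T (u k) w e| <= G w e} &
      {ae P, forall w e, grad T (u k) w e @[k --> \oo] --> F w e}].

Lemma minimizing_limit : exists (u : nat -> Om -> R) (F G : Om -> dir n -> R),
  [/\ forall k, bounded_measurable (u k),
      forall k h, bounded_measurable h -> energy (u k) <= energy h + 4^-1 ^+ k &
      dominated_limit u F G].
Proof.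
have [u uP] := energy_minimizers.
have bu k : bounded_measurable (u k) by have [] := uP k.
suff /choice[FG FGP] : forall e : dir n, exists FG : (Om -> R) * (Om -> R),
    [/\ measurable_fun setT FG.1, integ FG.2,
        {ae P, forall w k, `|grad T (u k) w e| <= FG.2 w} &
        {ae P, forall w, grad T (u k) w e @[k --> \oo] --> FG.1 w}].
  exists u, (fun w e => (FG e).1 w), (fun w e => (FG e).2 w).
  split=> //; first by move=> k; have [] := uP k.
  split=> [e|e||]; try by have [] := FGP e.
  - by apply: ae_forall_count => e; have [] := FGP e.
  - by apply: ae_forall_count => e; have [] := FGP e.
move=> e.
have [|k|F [G [mF iG dG cF]]] := @ae_cvg_of_summable _ _ _ P
  (fun k w => grad T (u k) w e) ((1 + \int[P]_w ivar e w) / 2).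
- move=> k; have [mg [M gM]] := bfield_grad (bu k) e.
  exact: integ_bounded gM.
- have [_ _ Qu] := uP k.
  under eq_Rintegral do rewrite -gradB.
  have K0 : (0 : R) < 2 ^+ k by rewrite exprn_gt0.
  apply: le_trans (Rintegral_grad_le e (bounded_measurableB (bu _) (bu _)) K0) _.
  rewrite mulrAC ler_wpM2r// mulrDl mul1r -exprVn [_ * \int[P]_w _]mulrC lerD2r.
  rewrite (le_trans (ler_wpM2l (ltW K0) Qu))// -exprMn.
  by rewrite (_ : 2 * 4^-1 = 2^-1)//; lra.
by exists (F, G).
Qed.

(** * First-order condition for the limit field *)

Lemma grad_lin (s t : R) h h' w e :
  grad T (fun v => s * h v + t * h' v) w e = s * grad T h w e + t * grad T h' w e.
Proof. by rewrite /grad; ring. Qed.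

Lemma half_expn_cvg0 : (2^-1 : R) ^+ k @[k --> \oo] --> (0 : R).
Proof. by apply: cvg_expr; rewrite ger0_norm; lra. Qed.

(* [drift x y] is the derivative of [exc ^ 2 / 2] at [x] along [y]. *)
Definition drift x y w := exc x w * \sum_e gibbsT x w e * y w e.

Lemma measurable_drift x y : (forall e, measurable_fun setT (x ^~ e)) ->
  (forall e, measurable_fun setT (y ^~ e)) -> measurable_fun setT (drift x y).
Proof.
move=> mx my; apply: measurable_funM; first exact: measurable_exc.
apply: measurable_sum => e; apply: measurable_funM => //; exact: measurable_gibbsT.
Qed.

Lemma drift_le x y w : `|drift x y w| <= exc x w * \sum_e `|y w e|.
Proof.
rewrite /drift normrM (ger0_norm (exc_ge0 _ _)) ler_wpM2l ?exc_ge0//.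
rewrite (le_trans (ler_norm_sum _ _ _))//; apply: ler_sum => e _.
have [/(_ e)/andP[q0 q1] _] := gibbs_weights (tilt (x w)) (wp w).
by rewrite normrM ger0_norm// ler_piMl.
Qed.

Lemma integ_drift x y : bfield x -> bfield y -> integ (drift x y).
Proof.
move=> bx by_; have [M MP] := bfield_bound bx; have [N NP] := bfield_bound by_.
apply: (@integ_bounded _ _ _ _ _
    ((expo + \sum_(e : dir n) M) * \sum_(e : dir n) N)).
  by apply: measurable_drift => e; [exact: (bx e).1|exact: (by_ e).1].
move=> w; rewrite (le_trans (drift_le _ _ _))// ler_pM ?exc_ge0 ?sumr_ge0//.
  by rewrite (le_trans (exc_le x w))// lerD2l ler_sum.
exact: ler_sum.
Qed.

Lemma bfieldB x y : bfield x -> bfield y -> bfield (fun w e => x w e - y w e).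
Proof.
move=> bx by_ e; have [mx [M xM]] := bx e; have [my [N yN]] := by_ e.
split; first exact: measurable_funB.
by exists (M + N) => w; rewrite (le_trans (ler_normB _ _))// lerD.
Qed.

(** Move [u k] towards [h] by a step [t k], reaching [v k]. The tangent inequality is taken at [v k]
    and evaluated at [u k], so near-minimality bounds the slope with no second-order term. The
    slopes have an integrable minorant only, hence Fatou's lemma. *)
Lemma limit_stationary u F G h : (forall k, bounded_measurable (u k)) ->
  (forall k h, bounded_measurable h -> energy (u k) <= energy h + 4^-1 ^+ k) ->
  dominated_limit u F G -> bounded_measurable h ->
  let f := drift F (fun w e => F w e - grad T h w e) in
  integ f /\ \int[P]_w f w <= 0.
Proof.
move=> bu Emin [mF iG dG cF] bh f.
have [M MP] := bfield_bound (bfield_grad bh).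
(* The exponent [k.+1] ensures [t k <= 1/2], as [gibbs_slope_ge] requires, and
   [2 * t k = 2^-1 ^+ k]. *)
pose t k : R := 2^-1 ^+ k.+1.
have t01 k : 0 < t k <= 2^-1.
  by rewrite exprn_gt0//= /t exprS ler_piMr// exprn_ile1//; lra.
have tn k : `|1 - t k| <= 1 /\ `|t k| <= 1.
  by have /andP[t0 t12] := t01 k; split; rewrite ger0_norm; lra.
pose v k w := (1 - t k) * u k w + t k * h w.
have bv k : bounded_measurable (v k) by exact: bounded_measurable_lin.
have gv k w e : grad T (v k) w e = (1 - t k) * grad T (u k) w e + t k * grad T h w e.
  exact: grad_lin.
have mgh e : measurable_fun setT (fun w => grad T h w e).
  exact: (bfield_grad bh e).1.
pose y k w e := grad T (u k) w e - grad T h w e.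
have bY k : bfield (y k).
  by apply: bfieldB; exact: bfield_grad.
(* Beyond [|a|], this sum bounds [lse] at the tilted gradient of [h]; [2 * c] is then the constant
   of [gibbs_slope_ge]. *)
pose c : R := `|a| + \sum_e (`|ip lam e| + M).
pose GG w : R := 2 * c * (expo + \sum_e (G w e + M)).
apply: (@fatou_Rintegral _ _ _ _ (fun k => drift (grad T (v k)) (y k)) f GG 0
  (fun k => 2^-1 ^+ k)).
- by move=> k; apply: integ_drift => //; exact: bfield_grad.
- apply: integZ; apply: integD; first exact: integ_cst.
  by apply: integ_sum => e; apply: integD => //; exact: integ_cst.
- apply: measurable_drift => // e; exact: measurable_funB.
- apply: filterS cF => w cFw.
  have cv e : grad T (v k) w e @[k --> \oo] --> F w e.
    under eq_cvg do rewrite gv.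
    have t0 : t k @[k --> \oo] --> (0 : R).
      rewrite -[X in _ --> X](mulr0 2^-1); under eq_cvg do rewrite /t exprS.
      by apply: cvgMl_tmp; exact: half_expn_cvg0.
    have c1 : (1 - t k) * grad T (u k) w e @[k --> \oo] --> (1 - 0) * F w e.
      by apply: cvgM => //; apply: cvgB => //; exact: cvg_cst.
    have c2 : t k * grad T h w e @[k --> \oo] --> 0 * grad T h w e.
      by apply: cvgM => //; exact: cvg_cst.
    by have := cvgD c1 c2; rewrite subr0 mul1r mul0r addr0; apply.
  have ct e : tilt (grad T (v k) w) e @[k --> \oo] --> tilt (F w) e.
    by apply: cvgD => //; exact: cvg_cst.
  apply: cvgM; first exact: cvg_excess.
  apply: cvg_big => [|e _]; first exact: add_continuous.
  by apply: cvgM; [exact: cvg_gibbs|apply: cvgB => //; exact: cvg_cst].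
- apply: filterS dG => w dGw k; have /andP[t0 t12] := t01 k.
  have M0 (e : dir n) : 0 <= M by exact: le_trans (normr_ge0 _) (MP w e).
  have c0 : 0 <= c by rewrite addr_ge0 ?sumr_ge0// => e _; rewrite addr_ge0 ?(M0 e).
  have XG : exc (grad T (v k)) w <= expo + \sum_e (G w e + M).
    rewrite (le_trans (exc_le _ _))// lerD2l; apply: ler_sum => e _.
    rewrite gv (le_trans (ler_normD _ _))// !normrM lerD//.
      by apply: le_trans (dGw e k); rewrite ler_piMl// (tn k).1.
    by apply: le_trans (MP w e); rewrite ler_piMl// (tn k).2.
  suff low : - (2 * c * exc (grad T (v k)) w) <= drift (grad T (v k)) (y k) w.
    by apply: le_trans low; rewrite lerN2 ler_wpM2l// mulr_ge0.
  rewrite /drift mulrC -mulrN; have := exc_ge0 (grad T (v k)) w.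
  rewrite le_eqVlt => /predU1P[<-|X0]; first by rewrite !mul0r.
  rewrite ler_pM2l//.
  have -> : \sum_e gibbsT (grad T (v k)) w e * y k w e =
      \sum_e gibbs (p w) (tilt (grad T (v k) w)) e *
        (tilt (grad T (u k) w) e - tilt (grad T h w) e).
    by apply: eq_bigr => e _; rewrite /tilt /y /gibbsT; congr (_ * _); ring.
  apply: (gibbs_slope_ge (t := t k) (wp w)) X0 _ _.
  - by rewrite (ltW t0).
  - by move=> e; rewrite /tilt gv; ring.
  - rewrite (le_trans (lse_le_norm _ (wp w)))//; apply: ler_sum => e _.
    by rewrite (le_trans (ler_normD _ _))// lerD2l.
  - by apply: sumr_ge0 => e _; rewrite addr_ge0 ?(M0 e).
- move=> k; rewrite add0r.
  have iv := integ_exc_sqr (bfield_grad (bv k)).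
  have iu := integ_exc_sqr (bfield_grad (bu k)).
  have idr := integ_drift (bfield_grad (bv k)) (bY k).
  set s := 2^-1 ^+ k; have s0 : 0 < s by rewrite exprn_gt0.
  (* Integrated tangent inequality; with [energy (u k) <= energy (v k) + s * s] it bounds the
     integral of the drift by [s]. *)
  have : energy (v k) + s * \int[P]_w drift (grad T (v k)) (y k) w <= energy (u k).
    rewrite /energy -RintegralZl// -RintegralD//; last exact: integZ.
    apply: le_Rintegral => //; first by apply: integD => //; exact: integZ.
    move=> w _.
    have := excess_sqr_grad a (tilt (grad T (v k) w)) (tilt (grad T (u k) w)) (wp w).
    have -> : \sum_i gibbs (p w) (tilt (grad T (v k) w)) i *
        (tilt (grad T (u k) w) i - tilt (grad T (v k) w) i) =
        t k * \sum_e gibbsT (grad T (v k)) w e * y k w e.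
      rewrite mulr_sumr; apply: eq_bigr => e _.
      by rewrite /tilt gv /y /gibbsT/=; ring.
    have -> : s = 2 * t k by rewrite /t exprS mulrA divff// mul1r.
    by rewrite /drift /exc; lra.
  have := Emin k _ (bv k); rewrite (_ : 4^-1 ^+ k = s * s); last first.
    by rewrite -exprMn; congr (_ ^+ _); lra.
  by move=> h1 h2; have := le_trans h2 h1; rewrite lerD2l ler_pM2l.
- exact: half_expn_cvg0.
Qed.

(** * The value of the variational functional at Gibbs transitions *)

Lemma qlogqp_gibbs x w e : qlogqp (gibbsT x w e) (p w e) =
  (gibbsT x w e * (tilt (x w) e - lseT x w))%:E.
Proof.
have S0 := expsum_gt0 (tilt (x w)) (wp w).
rewrite /qlogqp; have [q0|q0] := eqVneq (gibbsT x w e) 0; first by rewrite q0 mul0r.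
(* Gibbs weights vanish wherever [p] does, so the branch [+oo] is never reached. *)
have p0 : p w e != 0.
  by apply/eqP => pe0; move/eqP: q0; apply; rewrite /gibbsT /gibbs pe0 !mul0r.
rewrite (negbTE p0); congr (_ * _)%:E; rewrite /gibbsT /gibbs.
rewrite (_ : _ / _ = expR (tilt (x w) e) / expsum (p w) (tilt (x w))); last first.
  by field; rewrite p0 gt_eqF.
by rewrite ln_div ?posrE ?expR_gt0// expRK.
Qed.

(** For Gibbs weights [log (q / p) = <lambda, e> + F - lseT F], so the terms in [lambda] cancel and,
    the weights summing to 1, [lseT F] comes out of the sum. *)
Lemma Jfun_gibbs F (phi h : Om -> R) :
  Jfun P T p lam (gibbsT F) phi h =
  (\int[P]_w (phi w * (lseT F w - \sum_e gibbsT F w e * (F w e - grad T h w e)))%:E)%E.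
Proof.
apply: eq_integral => w _.
under eq_bigr do rewrite qlogqp_gibbs -EFinM -EFinB.
rewrite sumEFin; congr EFin.
have [_ q1] := gibbs_weights (tilt (F w)) (wp w).
rewrite [in RHS](_ : lseT F w = \sum_e gibbsT F w e * lseT F w); last first.
  by rewrite -mulr_suml [X in X * _]q1 mul1r.
rewrite -sumrB mulr_sumr.
by apply: eq_bigr => e _; rewrite /tilt /grad /gibbsT; ring.
Qed.

Lemma limit_integ_exc u F G : dominated_limit u F G -> integ (exc F).
Proof.
move=> [mF iG dG cF].
apply: (@integ_ae_le _ _ _ _ _ (fun w => expo + \sum_e G w e)).
- exact: measurable_exc.
- by apply: integD; [exact: integ_cst|exact: integ_sum].
apply: filterS2 dG cF => w dGw cFw; rewrite ger0_norm ?exc_ge0//.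
rewrite (le_trans (exc_le _ _))// lerD2l; apply: ler_sum => e _.
rewrite -(cvg_lim _ (cvg_norm (cFw e)))//; apply: limr_le.
  by apply: is_cvg_norm; exact: cvgP (cFw e).
by apply: nearW => k; exact: dGw.
Qed.

(** The test pair is [gibbsT F] with density [exc F / Z]. Where this density is positive,
    [lseT F > a], so for each [h] the integrand is at least [(a * exc F - D) / Z]; its integral is
    at least [a] because the drift [D] has nonpositive integral. *)
Lemma le_Gamma_of_limit u F G : (forall k, bounded_measurable (u k)) ->
  (forall k h, bounded_measurable h -> energy (u k) <= energy h + 4^-1 ^+ k) ->
  dominated_limit u F G -> 0 < \int[P]_w exc F w ->
  (a%:E <= Gamma P T p lam)%E.
Proof.
move=> bu Emin dl Z0; have [mF iG dG cF] := dl.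
have iX := limit_integ_exc dl; set Z := \int[P]_w _ in Z0.
pose phi w := Z^-1 * exc F w.
apply: le_trans (ereal_sup_ubound _); last first.
  exists (gibbsT F, phi) => //; split; first exact: gibbsT_transition.
  split; first by apply: measurable_funM => //; exact: measurable_exc.
  split=> [w|]; first by rewrite mulr_ge0 ?exc_ge0// invr_ge0 ltW.
  rewrite -EFin_Rintegral; last exact: integZ.
  by rewrite RintegralZl// mulVf// gt_eqF.
apply: le_ereal_inf_tmp => _ [h bh <-]; rewrite Jfun_gibbs/=.
have [id_ Id] := limit_stationary bu Emin dl bh.
set D := drift _ _ in id_ Id.
apply: (@le_trans _ _ (\int[P]_w (Z^-1 * (a * exc F w - D w))%:E)%E).
  have iB := integB (integZ a iX) id_.
  rewrite -EFin_Rintegral; last exact: integZ.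
  rewrite lee_fin RintegralZl// RintegralB//; last exact: integZ.
  rewrite RintegralZl// -/Z mulrBr [a * _]mulrC mulKf ?gt_eqF// lerBrDr gerDl.
  by rewrite mulr_ge0_le0// invr_ge0 ltW.
apply: le_integral_minorant.
- by apply: integZ; apply: integB => //; exact: integZ.
- apply/measurable_EFinP; apply: measurable_funM.
    by apply: measurable_funM => //; exact: measurable_exc.
  apply: measurable_funB; first exact: measurable_lseT.
  apply: measurable_sum => e; apply: measurable_funM; first exact: measurable_gibbsT.
  by apply: measurable_funB => //; exact: (bfield_grad bh e).1.
apply: aeW => w; rewrite lee_fin /phi -mulrA ler_wpM2l ?invr_ge0 ?(ltW Z0)//.
rewrite mulrBr lerD2r; have := exc_ge0 F w.
rewrite le_eqVlt => /predU1P[<-|X0]; first by rewrite mulr0 mul0r.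
have : exc F w = lseT F w - a by exact: excess_gt0 X0.
by rewrite [a * _]mulrC ler_pM2l// => XE; lra.
Qed.

(** * Membership of the limit field in the class K *)

Lemma ae_word (Q : Om -> Prop) (r : seq (dir n)) :
  {ae P, forall w, Q w} -> {ae P, forall w, Q (foldr T w r)}.
Proof.
elim: r Q => //= e r IH Q aeQ; apply: (IH (fun w => Q (T e w))).
exact: (ae_comp (mT e) (PT e) aeQ).
Qed.

(** Loop sums of gradients vanish by telescoping and involve finitely many orbit points; convergence
    along all words, off one null set, carries this to [F]. *)
Lemma limit_loops u F G : dominated_limit u F G ->
  {ae P, forall w, forall (x0 : 'I_n -> int) (r : seq (dir n)),
      endpt x0 r = x0 -> path_sum T F w x0 r = 0}.
Proof.
move=> [_ _ _ cF].
have /ae_forall_count : forall r : seq (dir n), {ae P, forall w, forall e,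
    grad T (u k) (foldr T w r) e @[k --> \oo] --> F (foldr T w r) e}.
  by move=> r; exact: (ae_word _ cF).
apply: filterS => w cFw x0 r closed.
have := @cvg_path_sum _ _ T R (fun k => grad T (u k)) F w cFw x0 r.
under eq_cvg do rewrite (path_sum_grad Tcomm Tinv) closed subrr.
by move/cvg_lim => <-//; exact: lim_cst.
Qed.

(** Gradients of bounded functions have mean 0 by invariance, and dominated convergence applies. *)
Lemma limit_mean0 u F G e : (forall k, bounded_measurable (u k)) ->
  dominated_limit u F G -> (\int[P]_w (F w e)%:E = 0)%E.
Proof.
move=> bu [mF iG dG cF].
have ig k : integ (fun w => grad T (u k) w e).
  by have [mg [M gM]] := bfield_grad (bu k) e; exact: integ_bounded gM.
have [|||||_ _ Fc] := @dominated_convergence _ _ _ P setT measurableT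
  (fun k w => (grad T (u k) w e)%:E) (fun w => (F w e)%:E) (fun w => (G w e)%:E).
- by move=> k; exact: (measurable_int P (ig k)).
- exact/measurable_EFinP.
- by apply: filterS cF => w cFw _; apply: cvg_EFin; [exact: nearW|exact: cFw].
- exact: iG.
- by apply: filterS dG => w dGw k _; rewrite /= lee_fin.
have z k : (\int[P]_w (grad T (u k) w e)%:E = 0)%E.
  have iu : integ (u k) by have [mu [M uM]] := bu k; exact: integ_bounded uM.
  have iuT := integ_comp (mT e) (PT e) iu.
  by rewrite -EFin_Rintegral// RintegralB// (Rintegral_comp (mT e) (PT e) iu) subrr.
rewrite -(cvg_lim _ Fc)// (_ : [sequence _]_n = fun=> 0%E) ?lim_cst//.
by apply/funext => k; exact: z.
Qed.

(** The bound [lseT F <= a] controls [F] from above only. Antisymmetry under edge reversal survives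
    the limit, so the upper bound at the other end of the edge is the lower bound here. *)
Lemma limit_abs_le u F G : dominated_limit u F G ->
  {ae P, forall w, lseT F w <= a} -> {ae P, forall w e, `|F w e| <= ivar e w}.
Proof.
move=> [mF iG dG cF] Fa.
have up : {ae P, forall w, forall e,
    F w e <= `|a| + `|ip lam e| + `|ln (p w e)|}.
  apply: filterS2 p_gt0 Fa => w pw Faw e.
  have := lse_ge (tilt (F w)) (wp w) (pw e); rewrite -/(lseT F w) /tilt.
  have := ler_norm a; have := ler_norm (- ip lam e).
  by have := ler_norm (- ln (p w e)); rewrite !normrN; lra.
have cFT : {ae P, forall w, forall e e',
    grad T (u k) (T e w) e' @[k --> \oo] --> F (T e w) e'}.
  by apply: ae_forall_count => e; exact: (ae_comp (mT e) (PT e) cF).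
have upT : {ae P, forall w, forall e e',
    F (T e w) e' <= `|a| + `|ip lam e'| + `|ln (p (T e w) e')|}.
  by apply: ae_forall_count => e; exact: (ae_comp (mT e) (PT e) up).
have anti : {ae P, forall w, forall e, F (T e w) (opp_dir e) = - F w e}.
  apply: filterS2 cF cFT => w cFw cFTw e.
  have c1 := cFTw e (opp_dir e).
  have c2 : - grad T (u k) w e @[k --> \oo] --> - F w e by apply: cvgN; exact: cFw.
  rewrite -(cvg_lim _ c1)// -(cvg_lim _ c2)//; congr (limn _).
  by apply/funext => k; rewrite (grad_opp Tinv).
apply: filterS3 up upT anti => w upw upTw antiw e.
have := upTw e (opp_dir e); rewrite antiw; have := upw e; rewrite ler_norml /ivar.
have := normr_ge0 a; have := normr_ge0 (ip lam e).
have := normr_ge0 (ip lam (opp_dir e)); have := normr_ge0 (ln (p w e)).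
have := normr_ge0 (ln (p (T e w) (opp_dir e))).
by move=> *; apply/andP; split; lra.
Qed.

Lemma limit_moment u F G (alpha : R) e : 0 < alpha ->
  (forall e, integ (fun w => `|ln (p w e)| `^ (n%:R + alpha))) ->
  dominated_limit u F G -> {ae P, forall w, lseT F w <= a} ->
  (\int[P]_w (`|F w e| `^ (n%:R + alpha))%:E < +oo)%E.
Proof.
move=> al0 lnps dl Fa; have [mF _ _ _] := dl.
set s := n%:R + alpha in lnps *; have s0 : 0 <= s by rewrite addr_ge0// ltW.
pose c := 1 + `|a| + `|ip lam e| + `|ip lam (opp_dir e)|.
have c0 : 0 <= c by rewrite /c !addr_ge0.
(* The sum is at most 3 times the largest term, whose power is at most the sum of the powers. *)
have pow3 (x y z : R) : 0 <= x -> 0 <= y -> 0 <= z ->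
    (x + y + z) `^ s <= 3 `^ s * (x `^ s + y `^ s + z `^ s).
  move=> x0 y0 z0.
  have mono (b : R) : 0 <= b -> x + y + z <= 3 * b ->
      (x + y + z) `^ s <= 3 `^ s * b `^ s.
    move=> b0 xb; rewrite -powRM//; apply: ge0_ler_powR => //.
      by rewrite nnegrE !addr_ge0.
    by rewrite nnegrE mulr_ge0.
  have xs := powR_ge0 x s; have ys := powR_ge0 y s; have zs := powR_ge0 z s.
  have ge3 (b : R) : b <= x `^ s + y `^ s + z `^ s ->
      3 `^ s * b <= 3 `^ s * (x `^ s + y `^ s + z `^ s).
    by apply: ler_wpM2l; exact: powR_ge0.
  have [xy|/ltW yx] := leP x y.
    have [yz|/ltW zy] := leP y z.
      by apply: le_trans (mono z z0 _) _; [lra|apply: ge3; lra].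
    by apply: le_trans (mono y y0 _) _; [lra|apply: ge3; lra].
  have [xz|/ltW zx] := leP x z.
    by apply: le_trans (mono z z0 _) _; [lra|apply: ge3; lra].
  by apply: le_trans (mono x x0 _) _; [lra|apply: ge3; lra].
apply: (integrable_lty measurableT).
apply: (@integ_ae_le _ _ _ _ _ (fun w => 3 `^ s * (c `^ s + `|ln (p w e)| `^ s
    + `|ln (p (T e w) (opp_dir e))| `^ s))).
- apply: (measurableT_comp (measurable_powR s)).
  exact: measurableT_comp.
- apply: integZ; apply: integD; first by apply: integD => //; exact: integ_cst.
  exact: (integ_comp (mT e) (PT e) (lnps (opp_dir e))).
apply: filterS (limit_abs_le dl Fa) => w /(_ e) Fw.
rewrite ger0_norm ?powR_ge0//; apply: le_trans (pow3 _ _ _ c0 _ _) => //.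
by apply: ge0_ler_powR => //; rewrite nnegrE// !addr_ge0.
Qed.

Lemma exists_classK (alpha : R) : 0 < alpha ->
  (forall e, integ (fun w => `|ln (p w e)| `^ (n%:R + alpha))) ->
  (Gamma P T p lam < a%:E)%E ->
  exists F, classK P T F /\ {ae P, forall w, lseT F w <= a}.
Proof.
move=> al0 lnps Ga; have [u [F [G [bu Emin dl]]]] := minimizing_limit.
have [mF _ _ _] := dl; have iX := limit_integ_exc dl.
have Fa : {ae P, forall w, lseT F w <= a}.
  have X0 : \int[P]_w exc F w = 0.
    apply/eqP; rewrite eq_le Rintegral_ge0 ?andbT; last first.
      by move=> w _; exact: exc_ge0.
    rewrite leNgt; apply/negP => /(le_Gamma_of_limit bu Emin dl).
    by rewrite leNgt Ga.
  apply: filterS (Rintegral_eq0_ae iX (exc_ge0 F) X0) => w Xw.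
  by have := lse_le_excess a (p w) (tilt (F w)); rewrite -/(exc F w) Xw addr0.
exists F; split=> //; split; last first.
  by split=> [e|]; [exact: limit_mean0 dl|exact: limit_loops dl].
by exists alpha => // e; split=> //; exact: limit_moment dl Fa.
Qed.

End Environment.

(** * Passage from levels above [Gamma] to the theorem, by cases on the value of [Gamma] *)

Theorem theorem3p4 (R : realType) (dd : measure_display)
  (Om : measurableType dd) (P : probability Om R) (n : nat)
  (T : dir n -> Om -> Om) (p : Om -> dir n -> R) :
  (1 <= n)%N ->
  countably_generated Om ->
  ergodic_family P T ->
  transition p ->
  (exists2 alpha : R, 0 < alpha & forall e : dir n,
     (\int[P]_w (if p w e == 0%R then +oo
                 else (`|ln (p w e)| `^ (n%:R + alpha))%:E) < +oo)%E) ->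
  forall (lam : 'I_n -> R) (eps : R), 0 < eps ->
  exists F : Om -> dir n -> R,
    classK P T F /\
    (ess_sup P (fun w => (ln (\sum_(e : dir n)
                              p w e * expR (ip lam e + F w e)))%:E)
       <= Gamma P T p lam + eps%:E)%E.
Proof.
move=> n0 _ [Tcomm [Tinv [mT [PT _]]]] tp [alpha al0 lp] lam eps eps0.
have s1 (b : R) : 0 < b -> 1 <= n%:R + b.
  by move=> b0; rewrite -[leLHS]addr0 lerD ?ler1n// ltW.
have [mp [p01 p1]] := tp.
have mlnp e : measurable_fun setT (fun w => ln (p w e)) by exact: measurableT_comp.
pose f e w := (if p w e == 0%R then +oo else (`|ln (p w e)| `^ (n%:R + alpha))%:E)%E.
have mf e : measurable_fun setT (f e).
  apply: measurable_fun_ifT => //; first exact: measurable_fun_eqr.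
  apply/measurable_EFinP; apply: (measurableT_comp (measurable_powR _)).
  exact: measurableT_comp.
have f0 e w : (0 <= f e w)%E.
  by rewrite /f; case: ifP; rewrite ?leey// lee_fin powR_ge0.
have fi e : P.-integrable setT (f e).
  by apply/integrableP; split=> //; under eq_integral do rewrite gee0_abs//; exact: lp.
(* The moment integrand is [+oo] where [p] vanishes, so its finite integral forces positivity almost
   surely. *)
have p_gt0 : {ae P, forall w, forall e, 0 < p w e}.
  apply: ae_forall_count => e; apply: filterS (integrable_ae measurableT (fi e)) => w.
  move=> /(_ Logic.I); rewrite /f lt_neqAle (andP (p01 w e)).1 andbT eq_sym.
  by case: eqP.
have lnps e : P.-integrable setT (EFin \o (fun w => `|ln (p w e)| `^ (n%:R + alpha))).
  apply: integ_powR => //; apply: le_lt_trans (lp e).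
  apply: ge0_le_integral => //.
  - apply/measurable_EFinP; apply: (measurableT_comp (measurable_powR _)).
    exact: measurableT_comp.
  - exact: mf.
  - by move=> w _; case: ifP; rewrite ?leey.
have lnp e : P.-integrable setT (EFin \o (fun w => ln (p w e))).
  exact: integ_of_moment (s1 _ al0) (mlnp e) (lnps e).
have main a : (Gamma P T p lam < a%:E)%E ->
    exists F, classK P T F /\ {ae P, forall w, lseT p lam F w <= a}.
  exact: (exists_classK Tcomm Tinv mT PT tp p_gt0 lnp al0 lnps).
case G : (Gamma P T p lam) => [r||].
- have [|F [KF Fa]] := main (r + eps); first by rewrite G lte_fin ltrDl.
  exists F; split=> //; apply/ess_supP; apply: filterS Fa => w Fw.
  by rewrite -EFinD lee_fin.
(* If [Gamma] is [+oo] the bound is void, and the zero field lies in the class. *)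
- exists (fun _ _ => 0); split; last by rewrite addye// leey.
  have s_neq0 : n%:R + alpha != 0 by rewrite gt_eqF// (lt_le_trans ltr01)// s1.
  split.
    exists alpha => // e; split; first exact: measurable_cst.
    by under eq_integral do rewrite normr0 powR0//; rewrite integral0 ltry.
  split=> [e|]; first by rewrite integral0.
  by apply: aeW => w x0 r _; elim: r x0 => //= e r IH x0; rewrite IH addr0.
(* The value [-oo] is impossible: at a very negative level, the bound from the single direction [e]
   gives [F <= |ln p| - c] almost surely. As [F] has mean 0 and [c] exceeds the mean of [|ln p|] by
   1, integration gives [0 <= -1]. *)
- exfalso; pose e : dir n := (Ordinal n0, true).
  have il : P.-integrable setT (EFin \o (fun w => `|ln (p w e)|)).
    exact: integrable_norm (lnp e).
  set c := \int[P]_w `|ln (p w e)| + 1.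
  have [|F [KF Fa]] := main (- (c + `|ip lam e|)); first by rewrite G ltNyr.
  have [[b b0 mom] [/(_ e) F0 _]] := KF; have [mF /(integ_powR mF) Fs] := mom e.
  have iF := integ_of_moment (s1 b b0) mF Fs.
  have : \int[P]_w F w e <= \int[P]_w (`|ln (p w e)| - c).
    apply: ae_le_Rintegral => //; first by apply: integB => //; exact: integ_cst.
    apply: filterS2 p_gt0 Fa => w pw Fw.
    have wp : weights (p w) by [].
    have := lse_ge (tilt lam (F w)) wp (pw e); rewrite /tilt.
    rewrite -/(tilt lam (F w)) -/(lseT p lam F w).
    have := ler_norm (- ln (p w e)); have := ler_norm (- ip lam e).
    by rewrite !normrN; lra.
  rewrite RintegralB//; last exact: integ_cst.
  rewrite Rintegral_cst_prob /c [X in X <= _](_ : _ = 0); last by rewrite /Rintegral F0.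
  lra.
Qed.
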